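(* Suppose $(M^n,g_{ij},f)$ is a compact linearly stable gradient shrinking Ricci soliton satisfying $R_{ij}+\nabla_i\nabla_j f=\frac{1}{2\tau}g_{ij}$ for a constant $\tau>0$. Let $\mathcal L_f$ be the operator on symmetric 2-tensors defined by $$\mathcal L_f h=\frac12\Delta_f h+Rm(h,\cdot).$$ Then, with the convention that $\lambda$ is an eigenvalue of $\mathcal L_f$ on $\ker\operatorname{div}_f$ if $\mathcal L_f h=-\lambda h$ for some non-zero $h\in\ker\operatorname{div}_f$, the number $-\frac{1}{2\tau}$ is the only negative eigenvalue of $\mathcal L_f$ on $\ker\operatorname{div}_f$ (with the Ricci tensor $Rc$ being an eigen-tensor), and the multiplicity of $-\frac1{2\tau}$ is one. In particular, $-\frac{1}{2\tau}$ is the least eigenvalue of $\mathcal L_f$ on $\ker\operatorname{div}_f$.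
   Context: $Rc=(R_{ij})$ is the Ricci tensor and $R$ the scalar curvature of $g$; indices are contracted with $g$. The curvature sign convention is such that $R_{ik}=R_{ijkl}g^{jl}$ (so $R_{ijij}>0$ on round spheres). Notation, for a smooth symmetric 2-tensor $h$, a 1-form $\omega$, and the potential function $f$: - $Rm(h,\cdot)$ is the symmetric 2-tensor $R_{ijkl}h_{jl}$ (free indices $i,k$). - $\operatorname{div}_f\omega=\nabla_i\omega_i-\omega_i\nabla_i f$ and $(\operatorname{div}_f h)_i=\nabla_j h_{ij}-h_{ij}\nabla_j f$; $\ker\operatorname{div}_f$ denotes the space of symmetric 2-tensors $h$ with $\operatorname{div}_f h=0$. - $(\operatorname{div}_f^{\dagger}\omega)_{ij}=-\frac12(\nabla_i\omega_j+\nabla_j\omega_i)$. - $\Delta_f=\Delta-\nabla f\cdot\nabla$, acting on functions and on tensors ($\Delta$ the rough Laplacian $\nabla_k\nabla_k$). Linear stability: the soliton is called linearly stable if the second variation of Perelman's $\nu$-entropy at $g$ is non-positive, i.e. if the stability operator $\hat N$ is $\le 0$ on symmetric 2-tensors, meaning $\int_M\langle\hat N h,h\rangle e^{-f}\,dV\le 0$ for every smooth symmetric 2-tensor $h$, where $$\hat N h=\frac12\Delta_f h+Rm(h,\cdot)+\operatorname{div}_f^{\dagger}\operatorname{div}_f h+\frac12\nabla^2\hat v_h-Rc\,\frac{\int_M\langle Rc,h\rangle e^{-f}\,dV}{\int_M R\,e^{-f}\,dV},$$ and $\hat v_h$ is the unique solution of $\Delta_f\hat v_h+\frac{\hat v_h}{2\tau}=\operatorname{div}_f\operatorname{div}_f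 h$ with $\int_M\hat v_h e^{-f}\,dV=0$. *)

(* Defs.v *)
From HB Require Import structures.
From mathcomp Require Import all_boot all_order all_algebra.
From mathcomp Require Import all_classical all_reals all_analysis.

Set Implicit Arguments.
Unset Strict Implicit.
Unset Printing Implicit Defensive.

Import Order.TTheory GRing.Theory Num.Theory.
Import numFieldNormedType.Exports.

Local Open Scope classical_set_scope.
Local Open Scope ring_scope.

Section SmoothFunctions.
Context {R : realType} {n : nat}.
Implicit Types (u : 'rV[R]_n -> R) (V : set 'rV[R]_n).

Definition pd (i : 'I_n) u : 'rV[R]_n -> R :=
  fun x => 'D_(delta_mx 0 i) u x.

Fixpoint Ck_on (k : nat) V u : Prop :=
  (forall x, V x -> {for x, continuous u}) /\
  if k is k'.+1 then
    forall i : 'I_n,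
      (forall x, V x -> derivable u x (delta_mx 0 i)) /\ Ck_on k' V (pd i u)
  else True.

(* Meant for open V. *)
Definition smooth_on V u : Prop := forall k, Ck_on k V u.

End SmoothFunctions.

(* Nonempty (pointed) smooth n-manifolds without boundary, given by a smooth atlas.  The maps
   coord a and param a are total, but only their restrictions to dom a and to
   coord a @` dom a are meaningful, where they are inverse to each other. *)
Record smoothManifold (R : realType) (n : nat) := SmoothManifold {
  carrier :> ptopologicalType;
  chart : Type;
  chart_at : carrier -> chart;
  dom : chart -> set carrier;
  coord : chart -> carrier -> 'rV[R]_n;
  param : chart -> 'rV[R]_n -> carrier;
  manifold_hausdorff : hausdorff_space carrier;
  manifold_second_countable : @second_countable carrier;
  mem_chart_at : forall p, dom (chart_at p) p;
  open_dom : forall a, open (dom a);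
  open_coord : forall a, open (coord a @` dom a);
  coordK : forall a p, dom a p -> param a (coord a p) = p;
  coord_continuous : forall a p, dom a p -> {for p, continuous (coord a)};
  param_continuous : forall a x, (coord a @` dom a) x ->
    {for x, continuous (param a)};
  transition_smooth : forall a b (k : 'I_n),
    smooth_on (coord a @` (dom a `&` dom b))
      (fun x => coord b (param a x) 0 k) }.

(* Tensor calculus in one chart.  A function, a 1-form or a 2-tensor is given
   by its components, as functions of the coordinates; g is the metric and f
   the potential.  The first index of a covariant derivative is the direction
   of differentiation. *)
Section LocalTensorCalculus.
Context {R : realType} {n : nat}.
Local Notation E := 'rV[R]_n.
Implicit Types (g h : E -> 'M[R]_n) (w : E -> 'rV[R]_n) (f v : E -> R).

Definition ginv g (i j : 'I_n) (x : E) : R := invmx (g x) i j.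

(* Gamma^l_ij *)
Definition christoffel g (l i j : 'I_n) (x : E) : R :=
  2^-1 * \sum_m ginv g l m x *
    (pd i (fun y => g y j m) x + pd j (fun y => g y i m) x
     - pd m (fun y => g y i j) x).

Definition grad v (x : E) : 'rV[R]_n := \row_i pd i v x.

Definition cov1 g w (x : E) : 'M[R]_n :=
  \matrix_(i, j) (pd i (fun y => w y 0 j) x
                  - \sum_l christoffel g l i j x * w x 0 l).

Definition hess g v : E -> 'M[R]_n := cov1 g (grad v).

Definition cov2 g h (k i j : 'I_n) (x : E) : R :=
  pd k (fun y => h y i j) x
  - \sum_l (christoffel g l k i x * h x l j + christoffel g l k j x * h x i l).

Definition cov3 g (T : 'I_n -> 'I_n -> 'I_n -> E -> R)
    (m k i j : 'I_n) (x : E) : R :=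
  pd m (T k i j) x
  - \sum_l (christoffel g l m k x * T l i j x
            + christoffel g l m i x * T k l j x
            + christoffel g l m j x * T k i l x).

(* R_ijkl = <R(d_i, d_j) d_l, d_k>, where
   R(X, Y) = nabla_X nabla_Y - nabla_Y nabla_X - nabla_[X, Y];
   thus R_ijkl = g_ik g_jl - g_il g_jk on the unit round sphere. *)
Definition riem g (i j k l : 'I_n) (x : E) : R :=
  \sum_m g x k m *
    (pd i (christoffel g m j l) x - pd j (christoffel g m i l) x
     + \sum_p (christoffel g m i p x * christoffel g p j l x
               - christoffel g m j p x * christoffel g p i l x)).

Definition ricci g (x : E) : 'M[R]_n :=
  \matrix_(i, k) \sum_j \sum_l riem g i j k l x * ginv g j l x.

Definition scalar_curv g (x : E) : R :=
  \sum_i \sum_j ginv g i j x * ricci g x i j.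

Definition inner2 g h h' (x : E) : R :=
  \sum_i \sum_j \sum_k \sum_l
    ginv g i k x * ginv g j l x * h x i j * h' x k l.

(* Rm(h, .)_ik = R_ijkl h^jl *)
Definition Rm_act g h (x : E) : 'M[R]_n :=
  \matrix_(i, k) \sum_j \sum_l \sum_p \sum_q
    riem g i j k l x * ginv g j p x * ginv g l q x * h x p q.

Definition divf1 g f w (x : E) : R :=
  \sum_i \sum_j ginv g i j x * (cov1 g w x i j - w x 0 i * pd j f x).

Definition divf2 g f h (x : E) : 'rV[R]_n :=
  \row_i \sum_j \sum_k ginv g j k x * (cov2 g h j i k x - h x i j * pd k f x).

Definition divf_dagger g w (x : E) : 'M[R]_n :=
  \matrix_(i, j) (- 2^-1 * (cov1 g w x i j + cov1 g w x j i)).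

Definition laplf0 g f v (x : E) : R :=
  \sum_k \sum_l ginv g k l x * (hess g v x k l - pd k f x * pd l v x).

Definition laplf2 g f h (x : E) : 'M[R]_n :=
  \matrix_(i, j) \sum_k \sum_l ginv g k l x *
    (cov3 g (cov2 g h) k l i j x - pd k f x * cov2 g h l i j x).

Definition Lf g f h (x : E) : 'M[R]_n :=
  2^-1 *: laplf2 g f h x + Rm_act g h x.

End LocalTensorCalculus.

(* Iterated Lebesgue integral over R^n; by Tonelli's theorem it is the Lebesgue
   integral for non-negative Borel functions. *)
Fixpoint lebesgue_iint (R : realType) (n : nat) :
    ('rV[R]_n -> \bar R) -> \bar R :=
  match n return ('rV[R]_n -> \bar R) -> \bar R with
  | 0%N => fun F => F 0
  | m.+1 => fun F => (\int[@lebesgue_measure R]_t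
      lebesgue_iint (fun y : 'rV[R]_m =>
        F (row_mx (t%:M : 'rV[R]_1) y : 'rV[R]_(1 + m))))%E
  end.

Section RiemannianManifolds.
Context {R : realType} {n : nat} (M : smoothManifold R n).
Local Notation E := 'rV[R]_n.

Definition chart_img (a : chart M) : set E := coord a @` dom a.

(* Components in every chart; only the values on chart_img a matter. *)
Definition tensor2 : Type := chart M -> E -> 'M[R]_n.

Definition eq_tensor2 (h k : tensor2) : Prop :=
  forall a x, chart_img a x -> h a x = k a x.

Definition smooth_fun (u : M -> R) : Prop :=
  forall a, smooth_on (chart_img a) (u \o param a).

Definition transition_jac (a b : chart M) (x : E) : 'M[R]_n :=
  \matrix_(i, k) pd i (fun y => coord b (param a y) 0 k) x.

Definition smooth_sym2 (h : tensor2) : Prop :=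
  [/\ forall a i j, smooth_on (chart_img a) (fun x => h a x i j),
      forall a x, chart_img a x -> (h a x)^T = h a x
    & forall a b x, (coord a @` (dom a `&` dom b)) x ->
        h a x = transition_jac a b x *m h b (coord b (param a x))
                *m (transition_jac a b x)^T].

Definition riemannian_metric (g : tensor2) : Prop :=
  smooth_sym2 g /\
  forall a x (y : 'rV[R]_n), chart_img a x -> y != 0 ->
    0 < (y *m g a x *m y^T) 0 0.

Definition borelM : measurableType (@open M).-sigma :=
  g_sigma_algebraType (@open M).

(* The Riemannian measure is the Borel measure with density (det g)^(1/2) in
   every chart; this determines it. *)
Definition riemannian_volume (g : tensor2)
    (vol : {measure set borelM -> \bar R}) : Prop :=
  forall (a : chart M) (u : borelM -> R),
    (forall p, 0 <= u p) -> measurable_fun setT u ->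
    (\int[vol]_(p in dom a) (u p)%:E)%E =
    lebesgue_iint (fun x => if x \in chart_img a
      then (u (param a x) * Num.sqrt (\det (g a x)))%:E else 0%E).

Section Operators.
Variables (g : tensor2) (f : M -> R) (tau : R)
  (vol : {measure set borelM -> \bar R}).

Definition at_point (s : chart M -> E -> R) (p : M) : R :=
  s (chart_at p) (coord (chart_at p) p).

Definition wint (u : M -> R) : R :=
  (\int[vol]_(p in setT) (u p * expR (- f p)))%R.

Definition Rc : tensor2 := fun a => ricci (g a).

Definition scal : M -> R := at_point (fun a => scalar_curv (g a)).

Definition inner (h k : tensor2) : M -> R :=
  at_point (fun a => inner2 (g a) (h a) (k a)).

Definition calLf (h : tensor2) : tensor2 :=
  fun a => Lf (g a) (f \o param a) (h a).

Definition ker_divf (h : tensor2) : Prop :=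
  smooth_sym2 h /\
  forall a x, chart_img a x -> divf2 (g a) (f \o param a) (h a) x = 0.

Definition gradient_shrinking_soliton : Prop :=
  [/\ riemannian_metric g, smooth_fun f
    & forall a x, chart_img a x ->
        ricci (g a) x + hess (g a) (f \o param a) x
        = (2 * tau)^-1 *: g a x].

Definition is_vhat (h : tensor2) (v : M -> R) : Prop :=
  [/\ smooth_fun v,
      forall a x, chart_img a x ->
        laplf0 (g a) (f \o param a) (v \o param a) x
        + v (param a x) / (2 * tau)
        = divf1 (g a) (f \o param a) (divf2 (g a) (f \o param a) (h a)) x
    & wint v = 0].

Definition stabN (h : tensor2) (v : M -> R) : tensor2 := fun a x =>
  2^-1 *: laplf2 (g a) (f \o param a) (h a) x
  + Rm_act (g a) (h a) x
  + divf_dagger (g a) (divf2 (g a) (f \o param a) (h a)) x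
  + 2^-1 *: hess (g a) (v \o param a) x
  - (wint (inner Rc h) / wint scal) *: ricci (g a) x.

(* On a compact shrinking soliton, v is uniquely determined by h. *)
Definition linearly_stable : Prop :=
  forall (h : tensor2) (v : M -> R), smooth_sym2 h -> is_vhat h v ->
    wint (inner (stabN h v) h) <= 0.

Definition nonzero2 (h : tensor2) : Prop := ~ eq_tensor2 h (fun _ _ => 0).

Definition eigenspace_Lf (lambda : R) (h : tensor2) : Prop :=
  ker_divf h /\ eq_tensor2 (calLf h) (fun a x => - lambda *: h a x).

Definition eigentensor_Lf (lambda : R) (h : tensor2) : Prop :=
  eigenspace_Lf lambda h /\ nonzero2 h.

Definition eigenvalue_Lf (lambda : R) : Prop :=
  exists h, eigentensor_Lf lambda h.

(* The eigenspace is one-dimensional. *)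
Definition multiplicity_one (lambda : R) : Prop :=
  exists2 h0, eigentensor_Lf lambda h0 &
    forall h, eigenspace_Lf lambda h ->
      exists c : R, eq_tensor2 h (fun a x => c *: h0 a x).

End Operators.
End RiemannianManifolds.

(* Main.v *)
(* On a soliton Rc = g/(2 tau) - Hess f.  Commuting covariant derivatives and the
   contracted second Bianchi identity give div_f Rc = 0 and
   Delta_f Hess f = - 2 Rm(Hess f, .), that is L_f Rc = Rc/(2 tau); moreover Rc
   is not zero, by the maximum principle for f.  If L_f h = - lambda h with
   div_f h = 0 and lambda < 0, then h' = h - s Rc, with s chosen so that h' is
   orthogonal to Rc, is a test tensor for which the stability form is
   - lambda |h'|^2 (the Rc-component of L_f h' is orthogonal to h').  Stability
   forces h' = 0, so h is a multiple of Rc and lambda = - 1/(2 tau).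
   The local identities hold in any commutative ring with commuting derivations,
   in particular in the ring of smooth functions on a chart. *)
From Pilot Require Import Defs.
From HB Require Import structures.
From mathcomp Require Import all_boot all_order all_algebra.
From mathcomp Require Import all_classical all_reals all_analysis.
From mathcomp Require Import measurable_realfun ring lra.
(* The constant coord of vector shadows the one of Defs. *)
Import Pilot.Defs.

Set Implicit Arguments.
Unset Strict Implicit.
Unset Printing Implicit Defensive.

Import Order.TTheory GRing.Theory Num.Theory.
Import numFieldNormedType.Exports.

Local Open Scope classical_set_scope.
Local Open Scope ring_scope.

(** * Local Riemannian geometry over a differential ring *)

(** The operators of the statement act on total functions whose values matter only on a chart image,
    which obstructs rewriting under derivatives. A smooth function extended by 0 off an open set is
    determined by its values there, so these extensions form a ring with plain equality; the tensor
    identities are proved over an abstract ring of this kind, where index sums and [ring] suffice,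
    and are then evaluated at a point. For $Rc$ to be a test tensor it must be symmetric and
    transform correctly between charts. Both are read off from $Rc=g/(2\tau)-\nabla^2f$, so that
    only the Hessian has to be followed through a change of coordinates. The other obstacle is the
    step from a non-positive integral of $|h'|^2$ to $h'=0$: the volume is given through iterated
    integrals in charts, and it has to be shown that it is finite on a compact manifold and positive
    on some open set inside every neighbourhood. *)

Ltac generalize_entries i j :=
  repeat match goal with |- context [fun_of_matrix ?X i j] =>
    let x := fresh "x" in set x := X i j; move: x => x end.

Section DifferentialRing.
Context {A : comPzRingType} {n : nat}.
Variables (D : 'I_n -> A -> A) (half : A).
Implicit Types (i j k l m p q a b c : 'I_n) (w : 'I_n -> A)
  (h : 'I_n -> 'I_n -> A).
Hypothesis DD : forall i, {morph D i : x y / x + y}.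
Hypothesis DM : forall i x y, D i (x * y) = D i x * y + x * D i y.
Hypothesis DC : forall i j x, D i (D j x) = D j (D i x).
Hypothesis half2 : half + half = 1.

Lemma der0 i : D i 0 = 0.
Proof. by apply: (addIr (D i 0)); rewrite -DD !add0r. Qed.

Lemma derN i (x : A) : D i (- x) = - D i x.
Proof. by apply/eqP; rewrite -addr_eq0 -DD addNr der0. Qed.

Lemma derB i (x y : A) : D i (x - y) = D i x - D i y.
Proof. by rewrite DD derN. Qed.

Lemma der_sum i (I : Type) (r : seq I) (P : pred I) (F : I -> A) :
  D i (\sum_(j <- r | P j) F j) = \sum_(j <- r | P j) D i (F j).
Proof. exact: (big_morph (D i) (DD i) (der0 i)). Qed.

Lemma der1 i : D i 1 = 0.
Proof.
have := DM i 1 1; rewrite !mulr1 mul1r => e.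
by apply: (addIr (D i 1)); rewrite add0r -e.
Qed.

Lemma der_nat i (b : bool) : D i b%:R = 0.
Proof. by case: b; [exact: der1 | exact: der0]. Qed.

Lemma double_inj (x y : A) : x + x = y + y -> x = y.
Proof. by move=> e; rewrite -[x]mul1r -[y]mul1r -half2 !mulrDl -!mulrDr e. Qed.

(** * The metric, its inverse and the Levi-Civita connection *)

Variables (g G : 'I_n -> 'I_n -> A).
Hypothesis gC : forall i j, g i j = g j i.
Hypothesis GC : forall i j, G i j = G j i.
Hypothesis gG : forall i k, \sum_j g i j * G j k = (i == k)%:R.

Lemma Gg i k : \sum_j G i j * g j k = (i == k)%:R.
Proof.
rewrite eq_sym -gG; apply: eq_bigr => j _.
by rewrite gC GC mulrC.
Qed.

Lemma sum_delta_l (F : 'I_n -> A) i : \sum_j (i == j)%:R * F j = F i.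
Proof.
rewrite (bigD1 i) //= eqxx mul1r big1 ?addr0 // => j ji.
by rewrite eq_sym (negbTE ji) mul0r.
Qed.

Lemma sum_delta_r (F : 'I_n -> A) i : \sum_j F j * (j == i)%:R = F i.
Proof.
by rewrite -[RHS](sum_delta_l _ i); apply: eq_bigr => j _; rewrite mulrC eq_sym.
Qed.

Lemma sum_gG (F : 'I_n -> A) i : \sum_j g i j * \sum_k G j k * F k = F i.
Proof.
under eq_bigr => j _ do rewrite mulr_sumr.
rewrite exchange_big /= -[RHS](sum_delta_l _ i); apply: eq_bigr => k _.
by rewrite -gG mulr_suml; apply: eq_bigr => j _; rewrite mulrA.
Qed.

Lemma sum_Gg (F : 'I_n -> A) i : \sum_j G i j * \sum_k g j k * F k = F i.
Proof.
under eq_bigr => j _ do rewrite mulr_sumr.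
rewrite exchange_big /= -[RHS](sum_delta_l _ i); apply: eq_bigr => k _.
by rewrite -Gg mulr_suml; apply: eq_bigr => j _; rewrite mulrA.
Qed.

(** This definition and those of the other tensors below follow [christoffel], [cov1], [cov2],
    [cov3], [riem] and [ricci] sum by sum, so that evaluation at a point goes term by term. *)
Definition dGam l i j : A :=
  half * \sum_m G l m * (D i (g j m) + D j (g i m) - D m (g i j)).

Lemma dGamC l i j : dGam l i j = dGam l j i.
Proof.
congr (_ * _); apply: eq_bigr => m _; rewrite (gC j i).
by rewrite [D i _ + _]addrC.
Qed.

Lemma g_dGam p i j :
  \sum_l g p l * dGam l i j = half * (D i (g j p) + D j (g i p) - D p (g i j)).
Proof.
under eq_bigr => l _ do rewrite mulrCA.
by rewrite -mulr_sumr sum_gG.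
Qed.

(** Metric compatibility. Lowering the upper index of each symbol by [g_dGam] leaves three
    derivatives of $g$ apiece; two pairs cancel and the two halves of $\partial_kg_{ij}$ add up. *)
Lemma der_g k i j :
  D k (g i j) = \sum_l dGam l k i * g l j + \sum_l dGam l k j * g i l.
Proof.
rewrite (eq_bigr (fun l => g j l * dGam l k i)); last first.
  by move=> l _; rewrite mulrC gC.
rewrite g_dGam (eq_bigr (fun l => g i l * dGam l k j)); last first.
  by move=> l _; rewrite mulrC.
rewrite g_dGam (gC j i) (gC k i) (gC k j).
by rewrite -[LHS]mul1r -half2; ring.
Qed.

Lemma der_G k i j :
  D k (G i j) = - (\sum_l dGam i k l * G l j + \sum_l dGam j k l * G i l).
Proof.
(* The derivative of $gG=\delta$; contraction with $G$ then isolates $\partial_kG$. *)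
have e p : \sum_q g p q * D k (G q j) = - \sum_q D k (g p q) * G q j.
  apply/eqP; rewrite -addr_eq0 -big_split /=.
  apply/eqP; rewrite -[RHS](der_nat k (p == j)) -gG der_sum.
  by apply: eq_bigr => q _; rewrite DM addrC.
rewrite -[LHS](sum_Gg (fun q => D k (G q j))).
under eq_bigr => p _ do rewrite e mulrN.
rewrite sumrN; congr (- _).
under eq_bigr => p _ do under eq_bigr => q _ do rewrite der_g mulrDl.
under eq_bigr => p _ do rewrite big_split /= mulrDr.
rewrite big_split /= addrC; congr (_ + _).
  rewrite -[RHS](sum_Gg (fun p => \sum_l dGam p k l * G l j)).
  apply: eq_bigr => p _; congr (_ * _).
  under eq_bigr => q _ do rewrite mulr_suml.
  rewrite exchange_big /=; apply: eq_bigr => q _.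
  by rewrite mulr_sumr; apply: eq_bigr => l _; ring.
under eq_bigr => p _ do under eq_bigr => q _ do rewrite mulr_suml.
under eq_bigr => p _ do rewrite exchange_big /=.
under [RHS]eq_bigr => p _ do rewrite mulrC.
apply: eq_bigr => p _; congr (_ * _).
rewrite -[RHS](sum_delta_r (fun l => dGam l k p)); apply: eq_bigr => l _.
by rewrite -gG mulr_sumr; apply: eq_bigr => q _; rewrite mulrA.
Qed.

Definition dcov1 w i j : A := D i (w j) - \sum_l dGam l i j * w l.

Definition dcov2 h k i j : A :=
  D k (h i j) - (\sum_l (dGam l k i * h l j + dGam l k j * h i l)).

Definition dcov3 (T : 'I_n -> 'I_n -> 'I_n -> A) m k i j : A :=
  D m (T k i j) - \sum_l (dGam l m k * T l i j + dGam l m i * T k l j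
                          + dGam l m j * T k i l).

(* R(d_i, d_j) d_l = K^m_ijl d_m *)
Definition dK m i j l : A :=
  D i (dGam m j l) - D j (dGam m i l)
  + \sum_p (dGam m i p * dGam p j l - dGam m j p * dGam p i l).

Definition driem i j k l : A := \sum_m g k m * dK m i j l.

Definition dric i k : A := \sum_j \sum_l driem i j k l * G j l.

Lemma dKN m i j l : dK m i j l = - dK m j i l.
Proof. by rewrite /dK opprD -sumrN opprB; congr (_ + _); apply: eq_bigr => p _; ring. Qed.

(** By the symmetry of the connection in its lower indices, the six derivative terms and the six
    quadratic terms each cancel in pairs. *)
Lemma dK_bianchi1 m i j l : dK m i j l + dK m j l i + dK m l i j = 0.
Proof.
rewrite /dK !sumrB (dGamC m l j) (dGamC m l i) (dGamC m j i).
have e a b c : \sum_p dGam m a p * dGam p b c = \sum_p dGam m a p * dGam p c b.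
  by apply: eq_bigr => p _; rewrite (dGamC p).
rewrite (e i l j) (e j l i) (e l j i); ring.
Qed.

Lemma dcov2B h h' k i j :
  dcov2 (fun i j => h i j - h' i j) k i j = dcov2 h k i j - dcov2 h' k i j.
Proof.
rewrite /dcov2 derB !big_split /=.
under eq_bigr => l _ do rewrite mulrBr.
under [X in _ - (_ + X)]eq_bigr => l _ do rewrite mulrBr.
by rewrite !sumrB; ring.
Qed.

Lemma dcov3B T T' m k i j :
  dcov3 (fun k i j => T k i j - T' k i j) m k i j
  = dcov3 T m k i j - dcov3 T' m k i j.
Proof.
rewrite /dcov3 derB.
have -> : forall x y z t : A, x - y - (z - t) = x - z - (y - t) by move=> *; ring.
by rewrite -sumrB; congr (_ - _); apply: eq_bigr => l _; ring.
Qed.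

Lemma dcov2_g k i j : dcov2 g k i j = 0.
Proof. by rewrite /dcov2 der_g big_split subrr. Qed.

(** * Connection and curvature matrices, and the Ricci identities *)

Local Notation Gmx k := (\matrix_(i, l) dGam l k i : 'M[A]_n).
Local Notation Kmx a b := (\matrix_(i, m) dK m a b i : 'M[A]_n).
Local Notation "\dd_ k X" := (map_mx (D k) X) (at level 10, k at level 8, X at level 9).

Lemma map_derM (r s t : nat) k (X : 'M[A]_(r, s)) (Y : 'M[A]_(s, t)) :
 \dd_k (X *m Y) = \dd_k X *m Y + X *m \dd_k Y.
Proof.
apply/matrixP => x y; rewrite !mxE der_sum -big_split; apply: eq_bigr => l _.
by rewrite DM !mxE.
Qed.

Lemma map_derB (r s : nat) k (X Y : 'M[A]_(r, s)) : \dd_k (X - Y) = \dd_k X - \dd_k Y.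
Proof. by apply/matrixP => x y; rewrite !mxE derB. Qed.

Lemma map_derD (r s : nat) k (X Y : 'M[A]_(r, s)) : \dd_k (X + Y) = \dd_k X + \dd_k Y.
Proof. by apply/matrixP => x y; rewrite !mxE DD. Qed.

Lemma map_derN (r s : nat) k (X : 'M[A]_(r, s)) : \dd_k (- X) = - \dd_k X.
Proof. by apply/matrixP => x y; rewrite !mxE derN. Qed.

Lemma map_derC (r s : nat) k l (X : 'M[A]_(r, s)) : \dd_k (\dd_l X) = \dd_l (\dd_k X).
Proof. by apply/matrixP => x y; rewrite !mxE DC. Qed.

Lemma addmxE (r s : nat) (X Y : 'M[A]_(r, s)) x y : (X + Y) x y = X x y + Y x y.
Proof. by rewrite mxE. Qed.

Lemma oppmxE (r s : nat) (X : 'M[A]_(r, s)) x y : (- X) x y = - X x y.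
Proof. by rewrite mxE. Qed.

Lemma mxE0 (r s : nat) x y : (0 : 'M[A]_(r, s)) x y = 0.
Proof. by rewrite mxE. Qed.

(** The structure equation $F=dA+A\wedge A$. Rows of [Gmx] carry the lower index and columns the
    upper one, the transpose of the usual convention, hence the reversed order of the two
    products. *)
Lemma KmxE a b :
  Kmx a b = \dd_a (Gmx b) - \dd_b (Gmx a) + Gmx b *m Gmx a - Gmx a *m Gmx b.
Proof.
apply/matrixP => i m; rewrite !mxE /dK -addrA -sumrB; congr (_ + _).
by apply: eq_bigr => p _; rewrite !mxE; ring.
Qed.

(* nabla h = D h - Gmx h - h Gmx^T *)
Lemma ricci_identity2_mx a b (X : 'M[A]_n) :
  let C k Y := \dd_k Y - Gmx k *m Y - Y *m (Gmx k)^T in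
  C a (C b X) - C b (C a X) = - (Kmx a b *m X) - X *m (Kmx a b)^T.
Proof.
move=> C; rewrite /C !KmxE; set X1 := Gmx a; set X2 := Gmx b.
rewrite !(map_derB, map_derM, mulmxBl, mulmxBr, mulmxDl, mulmxDr).
rewrite (map_derC a b).
have trD (Y Z : 'M[A]_n) : (Y + Z)^T = Y^T + Z^T by rewrite linearD.
have trN (Y : 'M[A]_n) : (- Y)^T = - Y^T by rewrite linearN.
rewrite !(trD, trN) !trmx_mul -!map_trmx.
rewrite !(mulmxBl, mulmxBr, mulmxDl, mulmxDr) !mulmxA.
(* Matrix products do not commute, so each expanded product is made one opaque entry; what is left
   is additive cancellation. *)
apply/matrixP => i j; rewrite !(addmxE, oppmxE); generalize_entries i j; ring.
Qed.

Lemma dcov2_mx h k :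
  \matrix_(i, j) dcov2 h k i j
  = \dd_k (\matrix_(i, j) h i j : 'M[A]_n) - Gmx k *m (\matrix_(i, j) h i j)
    - (\matrix_(i, j) h i j : 'M[A]_n) *m (Gmx k)^T.
Proof.
apply/matrixP => i j; rewrite !mxE /dcov2 big_split opprD addrA /=.
congr (_ - _ - _); apply: eq_bigr => l _; rewrite !mxE //.
by rewrite mulrC.
Qed.

(** Freezing the first index of [T] leaves a 2-tensor, to which the matrix calculus applies; the
    price is the correction in that index. *)
Lemma dcov3E T m k i j :
  dcov3 T m k i j = dcov2 (T k) m i j - \sum_l dGam l m k * T l i j.
Proof.
rewrite /dcov3 /dcov2 -!addrA -opprD -big_split /=.
by congr (_ - _); apply: eq_bigr => l _; ring.
Qed.

Lemma ricci_identity2 h m k i j :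
  dcov3 (dcov2 h) m k i j - dcov3 (dcov2 h) k m i j
  = - (\sum_p (dK p m k i * h p j + dK p m k j * h i p)).
Proof.
rewrite !dcov3E opprB addrA.
(* The corrections in the derivative index are symmetric in [m] and [k], as the connection has no
   torsion, and cancel. *)
under eq_bigr => l _ do rewrite dGamC.
rewrite subrK.
have e a b : dcov2 (dcov2 h b) a i j
    = (\matrix_(i, j) dcov2
         (fun i j => (\matrix_(i, j) dcov2 h b i j : 'M[A]_n) i j) a i j : 'M[A]_n) i j.
  rewrite mxE /dcov2 !mxE; congr (_ - _).
  by apply: eq_bigr => l _; rewrite !mxE.
have mxK (X : 'M[A]_n) : \matrix_(i, j) X i j = X by apply/matrixP => x y; rewrite mxE.
rewrite !e !dcov2_mx !mxK.
have := congr1 (fun X : 'M[A]_n => X i j) (ricci_identity2_mx m k (\matrix_(i, j) h i j)).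
rewrite /= addmxE oppmxE => ->; rewrite addmxE !oppmxE -opprD big_split /=.
congr (- (_ + _)); rewrite mxE; apply: eq_bigr => l _; rewrite !mxE //.
by rewrite mulrC.
Qed.

Lemma dcov1_mx w k :
  \col_i dcov1 w k i = \dd_k (\col_i w i : 'cV[A]_n) - Gmx k *m (\col_i w i).
Proof.
apply/matrixP => i j; rewrite !mxE /dcov1.
by congr (_ - _); apply: eq_bigr => l _; rewrite !mxE.
Qed.

Lemma ricci_identity1_mx a b (X : 'cV[A]_n) :
  let C k Y := \dd_k Y - Gmx k *m Y in
  C a (C b X) - C b (C a X) = - (Kmx a b *m X).
Proof.
move=> C; rewrite /C !KmxE; set X1 := Gmx a; set X2 := Gmx b.
rewrite !(map_derB, map_derM, mulmxBl, mulmxBr, mulmxDl, mulmxDr) (map_derC a b).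
rewrite !mulmxA.
apply/matrixP => i j; rewrite !(addmxE, oppmxE); generalize_entries i j; ring.
Qed.

Lemma ricci_identity1 w k i j :
  dcov2 (dcov1 w) k i j - dcov2 (dcov1 w) i k j = - \sum_m dK m k i j * w m.
Proof.
have e a b c : dcov2 (dcov1 w) a b c
    = dcov1 (dcov1 w b) a c - \sum_l dGam l a b * dcov1 w l c.
  rewrite /dcov2 [in RHS]/dcov1 big_split /=; ring.
rewrite !e opprB addrA.
under eq_bigr => l _ do rewrite dGamC.
rewrite subrK.
have e1 a b : dcov1 (dcov1 w b) a j
    = (\col_j dcov1 (fun i => (\col_j dcov1 w b j : 'cV[A]_n) i 0) a j : 'cV[A]_n) j 0.
  rewrite mxE {1 3}/dcov1 !mxE; congr (_ - _).
  by apply: eq_bigr => l _; rewrite !mxE.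
have mxK (X : 'cV[A]_n) : \col_i X i 0 = X.
  by apply/matrixP => x y; rewrite mxE [y]ord1.
rewrite !e1 !dcov1_mx !mxK.
have := congr1 (fun X : 'cV[A]_n => X j 0) (ricci_identity1_mx k i (\col_i w i)).
rewrite /= addmxE oppmxE => ->; rewrite oppmxE.
by congr (- _); rewrite mxE; apply: eq_bigr => l _; rewrite !mxE.
Qed.

(** * The covariant derivative of the curvature, its symmetries and the second Bianchi identity *)

Definition dcovK a m i j l : A :=
  D a (dK m i j l)
  + \sum_q (dGam m a q * dK q i j l - dGam q a l * dK m i j q
            - dGam q a i * dK m q j l - dGam q a j * dK m i q l).

Lemma dcovKN a m i j l : dcovK a m i j l = - dcovK a m j i l.
Proof.
rewrite /dcovK (dKN m i j) derN opprD -sumrN; congr (_ + _).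
apply: eq_bigr => q _.
by rewrite (dKN q i j) (dKN m i j) (dKN m q j) (dKN m i q); ring.
Qed.

(** The two endomorphism indices are absorbed in a commutator with the connection matrix; the
    corrections in the form indices [i] and [j] are split off because they drop out of the cyclic
    sum. *)
Lemma dcovKE a m i j l :
  dcovK a m i j l
  = (\dd_a (Kmx i j) + Kmx i j *m Gmx a - Gmx a *m Kmx i j) l m
    - (\sum_q dGam q a i * dK m q j l + \sum_q dGam q a j * dK m i q l).
Proof.
rewrite /dcovK !sumrB !mxE.
under [X in _ = _ + X - _ - _]eq_bigr => q _ do rewrite !mxE mulrC.
under [X in _ = _ - X - _]eq_bigr => q _ do rewrite !mxE.
by ring.
Qed.

(** The differentiated structure equation: second derivatives cancel because derivations commute,
    and the remaining products cancel once reassociated. *)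
Lemma Kmx_bianchi2 a i j :
  let N a i j := \dd_a (Kmx i j) + Kmx i j *m Gmx a - Gmx a *m Kmx i j in
  N a i j + N i j a + N j a i = 0.
Proof.
move=> N; rewrite /N !KmxE; set X1 := Gmx a; set X2 := Gmx i; set X3 := Gmx j.
rewrite !(map_derD, map_derN, map_derM, mulmxBl, mulmxBr, mulmxDl, mulmxDr).
rewrite (map_derC i a) (map_derC j a) (map_derC j i) !mulmxA.
apply/matrixP => x y; rewrite !(addmxE, oppmxE) !mxE0.
generalize_entries x y; ring.
Qed.

Lemma bianchi2 a m i j l :
  dcovK a m i j l + dcovK i m j a l + dcovK j m a i l = 0.
Proof.
rewrite !dcovKE.
have := congr1 (fun X : 'M[A]_n => X l m) (Kmx_bianchi2 a i j).
rewrite /= !(addmxE, oppmxE) mxE0 => e.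
(* Exchanging the lower indices of the connection turns a correction in one form index into minus a
   correction in the other, so the six corrections cancel in pairs. *)
have sK b c d : \sum_q dGam q b c * dK m q d l = - \sum_q dGam q c b * dK m d q l.
  by rewrite -sumrN; apply: eq_bigr => q _; rewrite dGamC (dKN m q d); ring.
rewrite (sK a i j) (sK i j a) (sK j a i) -[RHS]e; ring.
Qed.

Lemma riemN_l i j k l : driem i j k l = - driem j i k l.
Proof. by rewrite -sumrN; apply: eq_bigr => m _; rewrite dKN mulrN. Qed.

(** The Ricci identity applied to $g$ itself: the commutator vanishes because $\nabla g=0$, and the
    curvature side is the symmetrization in the last two indices. *)
Lemma riemN_r i j k l : driem i j k l = - driem i j l k.
Proof.
apply/eqP; rewrite -addr_eq0; apply/eqP.
have := ricci_identity2 g i j l k.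
have z m k' i' j' : dcov3 (dcov2 g) m k' i' j' = 0.
  rewrite /dcov3 dcov2_g der0 big1 ?subrr // => q _.
  by rewrite !dcov2_g !mulr0 !addr0.
rewrite !z subrr => /esym /eqP; rewrite oppr_eq0 big_split /= => /eqP <-.
by congr (_ + _); apply: eq_bigr => m _; rewrite mulrC // gC.
Qed.

Lemma riem_bianchi1 i j k l :
  driem i j k l + driem j l k i + driem l i k j = 0.
Proof.
rewrite -!big_split /= big1 // => m _.
by rewrite -!mulrDr dK_bianchi1 mulr0.
Qed.

Lemma riem_pairC i j k l : driem i j k l = driem k l i j.
Proof.
apply: double_inj.
apply/eqP; rewrite -subr_eq0; apply/eqP.
pose b x y z t := driem x y z t + driem y t z x + driem t x z y.
have b0 x y z t : b x y z t = 0 by exact: riem_bianchi1.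
(* The octahedron argument: given antisymmetry in each pair, these four cyclic sums combine to twice
   the difference. *)
rewrite (_ : _ - _ = b i j k l - b i j l k - b k l i j + b k l j i).
  by rewrite !b0 !subr0 addr0.
rewrite /b (riemN_r j l k i) (riemN_l l i k j) (riemN_r i l k j).
rewrite (riemN_r i j l k) (riemN_r j k l i) (riemN_l k i l j).
rewrite (riemN_r i k l j) (riemN_l l j i k) (riemN_r k l j i).
by rewrite (riemN_l l i j k); ring.
Qed.

Definition dcovR a i j k l : A := \sum_m g k m * dcovK a m i j l.

(** Since $\nabla g=0$, lowering an index commutes with $\nabla$. Thus [dcovR] is the covariant
    derivative of [driem] and inherits its pair symmetry. *)
Lemma dcovRE a i j k l :
  dcovR a i j k l
  = D a (driem i j k l)
    - \sum_q (dGam q a i * driem q j k l + dGam q a j * driem i q k l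
              + dGam q a k * driem i j q l + dGam q a l * driem i j k q).
Proof.
have e1 : D a (driem i j k l) = \sum_q dGam q a k * driem i j q l
    + \sum_m \sum_q g k m * (dGam m a q * dK q i j l)
    + \sum_m g k m * D a (dK m i j l).
  rewrite der_sum [X in _ = _ + X + _]exchange_big /=.
  under [X in _ = X + _ + _]eq_bigr => q _ do rewrite mulr_sumr.
  rewrite [X in _ = X + _ + _]exchange_big -!big_split; apply: eq_bigr => m _ /=.
  rewrite DM der_g mulrDl !mulr_suml; congr (_ + _ + _).
    by apply: eq_bigr => q _; ring.
  by apply: eq_bigr => q _; ring.
have e2 (F : 'I_n -> A) (S : 'I_n -> 'I_n -> A) :
    \sum_m g k m * \sum_q F q * S q m = \sum_q F q * \sum_m g k m * S q m.
  under eq_bigr => m _ do rewrite mulr_sumr.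
  rewrite exchange_big /=; apply: eq_bigr => q _; rewrite mulr_sumr.
  by apply: eq_bigr => m _; ring.
rewrite e1 /dcovR /dcovK.
under eq_bigr => m _ do rewrite !sumrB mulrDr !mulrBr mulr_sumr.
rewrite big_split /= !sumrB !e2 !big_split /= /driem; ring.
Qed.

Lemma dcovR_pairC a i j k l : dcovR a i j k l = dcovR a k l i j.
Proof.
rewrite !dcovRE (riem_pairC i j k l); congr (_ - _).
apply: eq_bigr => q _.
rewrite (riem_pairC q j) (riem_pairC i q) (riem_pairC i j q) (riem_pairC i j k).
ring.
Qed.

Lemma dcovRN_l a i j k l : dcovR a i j k l = - dcovR a j i k l.
Proof. by rewrite -sumrN; apply: eq_bigr => m _; rewrite dcovKN mulrN. Qed.

Lemma dcovRN_r a i j k l : dcovR a i j k l = - dcovR a i j l k.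
Proof. by rewrite dcovR_pairC dcovRN_l dcovR_pairC. Qed.

Lemma dcovR_bianchi2 a i j k l :
  dcovR a i j k l + dcovR i j a k l + dcovR j a i k l = 0.
Proof.
rewrite -!big_split /= big1 // => m _.
by rewrite -!mulrDr bianchi2 mulr0.
Qed.

(** A plain trace over an upper and a lower index leaves no metric to differentiate. *)
Lemma dricE i k : dric i k = \sum_j dK j j i k.
Proof.
transitivity (\sum_j - \sum_l G j l * driem i j l k).
  apply: eq_bigr => j _; rewrite -sumrN; apply: eq_bigr => l _.
  by rewrite riemN_r mulNr mulrC.
by apply: eq_bigr => j _; rewrite sum_Gg -dKN.
Qed.

Lemma dcov2_ext h h' k i j : (forall i j, h i j = h' i j) ->
  dcov2 h k i j = dcov2 h' k i j.
Proof.
move=> e; rewrite /dcov2 e; congr (_ - _); apply: eq_bigr => l _.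
by rewrite !e.
Qed.

Lemma dcov3_ext T T' m k i j : (forall k i j, T k i j = T' k i j) ->
  dcov3 T m k i j = dcov3 T' m k i j.
Proof.
move=> e; rewrite /dcov3 e; congr (_ - _); apply: eq_bigr => l _.
by rewrite !e.
Qed.

Lemma dcov2_ric a i k : dcov2 dric a i k = \sum_j dcovK a j j i k.
Proof.
rewrite (dcov2_ext _ _ _ dricE) /dcov2 der_sum /dcovK.
under [RHS]eq_bigr => j _ do rewrite !sumrB.
rewrite [RHS]big_split /= !sumrB; congr (_ + _).
(* The connection terms of the two contracted indices are the same double sum in the two orders, and
   cancel. *)
rewrite [X in _ = X - _ - _ - _]exchange_big /=.
rewrite big_split /=.
under eq_bigr => l _ do rewrite mulr_sumr.
under [X in _ + X]eq_bigr => l _ do rewrite mulr_sumr.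
rewrite exchange_big /= [X in _ + X]exchange_big /=; ring.
Qed.

(** * Metric traces and their derivatives *)

Definition dtr h : A := \sum_k \sum_l G k l * h k l.

Lemma eq_dtr h h' : (forall k l, h k l = h' k l) -> dtr h = dtr h'.
Proof.
by move=> e; apply: eq_bigr => k _; apply: eq_bigr => l _; rewrite e.
Qed.

Lemma dtrD h h' : dtr (fun k l => h k l + h' k l) = dtr h + dtr h'.
Proof.
rewrite -big_split; apply: eq_bigr => k _; rewrite -big_split.
by apply: eq_bigr => l _; rewrite mulrDr.
Qed.

Lemma dtrN h : dtr (fun k l => - h k l) = - dtr h.
Proof.
rewrite -sumrN; apply: eq_bigr => k _; rewrite -sumrN.
by apply: eq_bigr => l _; rewrite mulrN.
Qed.

Lemma dtrB h h' : dtr (fun k l => h k l - h' k l) = dtr h - dtr h'.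
Proof. by rewrite dtrD dtrN. Qed.

Lemma dtrC h : dtr (fun k l => h l k) = dtr h.
Proof.
rewrite /dtr exchange_big; apply: eq_bigr => k _; apply: eq_bigr => l _.
by rewrite GC.
Qed.

Lemma dtr_sum (S : 'I_n -> 'I_n -> 'I_n -> A) :
  dtr (fun k l => \sum_p S p k l) = \sum_p dtr (S p).
Proof.
rewrite [RHS]exchange_big; apply: eq_bigr => k _ /=.
by rewrite [RHS]exchange_big; apply: eq_bigr => l _ /=; rewrite mulr_sumr.
Qed.

Lemma dtrMr h x : dtr (fun k l => h k l * x) = dtr h * x.
Proof.
rewrite mulr_suml; apply: eq_bigr => k _; rewrite mulr_suml.
by apply: eq_bigr => l _; rewrite mulrA.
Qed.

Lemma dtrMl h x : dtr (fun k l => x * h k l) = x * dtr h.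
Proof. by rewrite mulrC -dtrMr; apply: eq_dtr => k l; rewrite mulrC. Qed.

Lemma dtr_dtr (S : 'I_n -> 'I_n -> 'I_n -> 'I_n -> A) :
  dtr (fun k l => dtr (S k l)) = dtr (fun i j => dtr (fun k l => S k l i j)).
Proof.
rewrite /dtr.
under eq_bigr => k _ do under eq_bigr => l _ do rewrite mulr_sumr.
under eq_bigr => k _ do rewrite exchange_big.
rewrite exchange_big; apply: eq_bigr => i _ /=.
under eq_bigr => k _ do under eq_bigr => l _ do rewrite mulr_sumr.
under eq_bigr => k _ do rewrite exchange_big.
rewrite exchange_big; apply: eq_bigr => j _ /=.
rewrite mulr_sumr; apply: eq_bigr => k _; rewrite mulr_sumr.
by apply: eq_bigr => l _; ring.
Qed.

(** The derivatives of $G$, given by [der_G], are exactly the connection terms of $\nabla h$. *)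
Lemma der_dtr h i : D i (dtr h) = dtr (dcov2 h i).
Proof.
rewrite /dcov2 dtrB /dtr der_sum.
under eq_bigr => k _ do rewrite der_sum.
under eq_bigr => k _ do under eq_bigr => l _ do rewrite DM addrC der_G mulNr mulrDl.
under eq_bigr => k _ do rewrite sumrB big_split /=.
rewrite sumrB big_split /=; congr (_ - _).
under [RHS]eq_bigr => k _ do under eq_bigr => l _ do rewrite big_split /= mulrDr.
under [RHS]eq_bigr => k _ do rewrite big_split /=.
rewrite [RHS]big_split /=; congr (_ + _).
  rewrite exchange_big [RHS]exchange_big /=; apply: eq_bigr => l _.
  under eq_bigr => k _ do rewrite mulr_suml.
  under [RHS]eq_bigr => k _ do rewrite mulr_sumr.
  rewrite exchange_big /=; apply: eq_bigr => k _; apply: eq_bigr => p _.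
  by ring.
apply: eq_bigr => k _.
under eq_bigr => l _ do rewrite mulr_suml.
under [RHS]eq_bigr => l _ do rewrite mulr_sumr.
by rewrite exchange_big /=; apply: eq_bigr => l _; apply: eq_bigr => p _; ring.
Qed.

Lemma dcov1_contract (S : 'I_n -> 'I_n -> 'I_n -> A) i j :
  dcov1 (fun j => dtr (fun k l => S k l j)) i j
  = dtr (fun k l => dcov3 S i k l j).
Proof.
rewrite /dcov1 der_dtr.
rewrite (eq_bigr _ (fun p _ => esym (dtrMl (fun k l => S k l p) (dGam p i j)))).
rewrite -(dtr_sum (fun p k l => dGam p i j * S k l p)) -dtrB.
apply: eq_dtr => k l; rewrite /dcov2 /dcov3 -addrA -opprD; congr (_ - _).
by rewrite -big_split.
Qed.

Lemma dcov1_dtr_mul h w i j :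
  dcov1 (fun j => dtr (fun p q => h j p * w q)) i j
  = dtr (fun p q => dcov2 h i j p * w q + h j p * dcov1 w i q).
Proof.
rewrite (dcov1_contract (fun p q j => h j p * w q)); apply: eq_dtr => p q.
rewrite /dcov3 DM /dcov2 /dcov1 mulrBl mulrBr addrACA -opprD; congr (_ - _).
rewrite mulr_suml mulr_sumr -big_split; apply: eq_bigr => l _ /=; ring.
Qed.

(** * Shrinking solitons: [F] is the differential of the potential and [mu] is $1/(2\tau)$ *)

Variables (F : 'I_n -> A) (mu : A).
Hypothesis DF : forall i j, D i (F j) = D j (F i).
Hypothesis Dmu : forall i, D i mu = 0.

(** [H], [T] and [U] are the second, third and fourth covariant derivatives of the potential,
    outermost derivative first. *)
Local Notation H := (dcov1 F).
Local Notation T := (dcov2 H).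
Local Notation U := (dcov3 T).

Hypothesis soliton : forall i k, dric i k + H i k = mu * g i k.

Let dricH i k : dric i k = mu * g i k - H i k.
Proof. by rewrite -soliton addrK. Qed.

Let HC i j : H i j = H j i.
Proof.
by rewrite /dcov1 DF; congr (_ - _); apply: eq_bigr => l _; rewrite dGamC.
Qed.

Let TC k i j : T k i j = T k j i.
Proof.
rewrite /dcov2 HC; congr (_ - _); apply: eq_bigr => l _.
by rewrite (HC l j) (HC i l) addrC.
Qed.

Let dcov2_dricT k i j : dcov2 dric k i j = - T k i j.
Proof.
rewrite (dcov2_ext _ _ _ dricH) dcov2B -[RHS]add0r; congr (_ - _).
transitivity (mu * dcov2 g k i j); last by rewrite dcov2_g mulr0.
rewrite /dcov2 DM Dmu mul0r add0r mulrBr mulr_sumr; congr (_ - _).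
by apply: eq_bigr => l _; ring.
Qed.

Let Fu m := \sum_q G m q * F q.

Let dK_F i j l : \sum_m dK m i j l * F m = \sum_k driem i j k l * Fu k.
Proof.
rewrite /driem; under [RHS]eq_bigr => k _ do rewrite mulr_suml.
rewrite exchange_big /=; apply: eq_bigr => m _.
rewrite -(sum_gG F m) mulr_sumr; apply: eq_bigr => k _.
by rewrite (gC k m) -/(Fu k); ring.
Qed.

Let T_comm k i j : T k i j - T i k j = - \sum_m dK m k i j * F m.
Proof. exact: ricci_identity1. Qed.

Let dcov3_swap (S : 'I_n -> 'I_n -> 'I_n -> A) m k i j :
  dcov3 (fun k i j => S i k j) m k i j = dcov3 S m i k j.
Proof. by congr (_ - _); apply: eq_bigr => l _; ring. Qed.

(** The covariant derivative of [T_comm], expanded by the Leibniz rule. *)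
Let U_comm23 m k i j : U m k i j - U m i k j =
  - (\sum_p dcovK m p k i j * F p) - \sum_p dK p k i j * H m p.
Proof.
rewrite -(dcov3_swap T m k i j) -dcov3B (dcov3_ext _ _ _ _ T_comm) /dcov3 derN der_sum.
have -> : \sum_l (dGam l m k * (- \sum_q dK q l i j * F q)
    + dGam l m i * (- \sum_q dK q k l j * F q)
    + dGam l m j * (- \sum_q dK q k i l * F q))
  = - \sum_q \sum_l (dGam l m k * dK q l i j + dGam l m i * dK q k l j
       + dGam l m j * dK q k i l) * F q.
  rewrite -sumrN; under [RHS]eq_bigr => q _ do rewrite -sumrN.
  rewrite [RHS]exchange_big /=; apply: eq_bigr => l _.
  rewrite !mulrN !mulr_sumr -!opprD -!big_split /= -sumrN.
  by apply: eq_bigr => q _; ring.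
(* The connection terms of the contracted index [p] are grouped in one parenthesis because they
   cancel after summation over [p]. *)
have e p : dcovK m p k i j * F p + dK p k i j * H m p
  = D m (dK p k i j * F p) + (\sum_q dGam p m q * dK q k i j * F p
     - dK p k i j * \sum_q dGam q m p * F q)
    - \sum_l (dGam l m k * dK p l i j + dGam l m i * dK p k l j
       + dGam l m j * dK p k i l) * F p.
  rewrite DM /dcovK /dcov1 !sumrB -!mulr_suml !big_split /=; ring.
rewrite -[RHS]opprD -[in RHS]big_split /= (eq_bigr _ (fun p _ => e p)).
rewrite sumrB big_split /= sumrB.
have -> : \sum_p \sum_q dGam p m q * dK q k i j * F p
   = \sum_q dK q k i j * \sum_p dGam p m q * F p.
  rewrite exchange_big /=; apply: eq_bigr => q _; rewrite mulr_sumr.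
  by apply: eq_bigr => p _; ring.
by rewrite subrr addr0 opprK opprB addrC.
Qed.

Let U_comm12 m k i j : U m k i j - U k m i j
  = - (\sum_p (dK p m k i * H p j + dK p m k j * H i p)).
Proof. exact: ricci_identity2. Qed.

Let tr_riem i j : dtr (fun k l => driem k i l j) = dric i j.
Proof.
apply: eq_bigr => k _; apply: eq_bigr => l _.
by rewrite riemN_l riemN_r opprK mulrC riem_pairC riemN_l riemN_r opprK riem_pairC.
Qed.

Let dK_raise p i j l : dK p i j l = \sum_q G p q * driem i j q l.
Proof. by rewrite sum_Gg. Qed.

Let tr_dK p i : dtr (fun k l => dK p k i l) = - \sum_q G p q * dric i q.
Proof.
rewrite (eq_dtr (fun k l => dK_raise p k i l)) dtr_sum -sumrN.
apply: eq_bigr => q _; rewrite dtrMl -mulrN; congr (_ * _).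
by rewrite -tr_riem -dtrN; apply: eq_dtr => k l; rewrite riemN_r.
Qed.

Let tr_dcovR a i j : dtr (fun k l => dcovR a k i l j) = - T a i j.
Proof.
rewrite -dcov2_dricT dcov2_ric; apply: eq_bigr => k _.
exact: sum_Gg.
Qed.

(** After the pair symmetry, the derivative index [k] enters a second Bianchi sum with [j] and [m];
    the other two terms of that sum trace to derivatives of $Rc$, that is of $-\nabla^2f$. *)
Let div_dcovR i j m : dtr (fun k l => dcovR k l i j m) = T m j i - T j m i.
Proof.
rewrite -[T m j i]opprK -(tr_dcovR m) -(tr_dcovR j) -dtrN -dtrD.
apply: eq_dtr => k l; rewrite dcovR_pairC (dcovRN_l j k m).
apply/eqP; rewrite -opprD -addr_eq0 (addrC (dcovR m _ _ _ _)) addrA.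
by rewrite dcovR_bianchi2.
Qed.

Let X m := dtr (fun k l => T k l m).

(** One more trace of [div_dcovR] gives the twice contracted Bianchi identity
    $2\operatorname{div}Rc=dR$, here written for $\nabla^2f$ in place of $-Rc$. *)
Let X2 m : X m + X m = dtr (T m).
Proof.
have e : dtr (fun i j => dtr (fun k l => dcovR k l i j m)) = X m.
  rewrite -dtr_dtr; apply: eq_dtr => k l; rewrite -[RHS]opprK -tr_dcovR -dtrN.
  by apply: eq_dtr => i j; rewrite dcovRN_l.
rewrite -{1}e (eq_dtr (fun i j => div_dcovR i j m)) dtrB (dtrC (T m)).
rewrite (_ : dtr (fun i j => T j m i) = X m) ?subrK // /X -dtrC.
by apply: eq_dtr => k l; rewrite TC.
Qed.

(** Commuting derivatives gives the Bochner formula $\operatorname{div}\nabla^2f-\nabla\Delta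
    f=Rc(\nabla f)$, in which [X2] replaces $\nabla\Delta f$ by twice the divergence. *)
Let X_ric i : X i = - dtr (fun j k => dric i j * F k).
Proof.
have e : X i - dtr (T i) = dtr (fun j k => dric i j * F k).
  rewrite /X -dtrB.
  rewrite (eq_dtr (fun j k => congr1 (fun x => x - T i j k) (TC j k i))).
  rewrite (eq_dtr (fun j k => T_comm j i k)) dtrN dtr_sum -sumrN.
  rewrite [RHS]exchange_big; apply: eq_bigr => m _ /=.
  rewrite dtrMr tr_dK mulNr opprK mulr_suml; apply: eq_bigr => q _.
  by rewrite GC; ring.
by rewrite -e -X2 opprB addrK.
Qed.

Lemma divf_ric i :
  \sum_j \sum_k G j k * (dcov2 dric j i k - dric i j * F k) = 0.
Proof.
rewrite -/(dtr (fun j k => dcov2 dric j i k - dric i j * F k)) dtrB.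
rewrite (eq_dtr (fun j k => dcov2_dricT j i k)) dtrN.
rewrite (eq_dtr (fun j k => TC j i k)) -/(X i) X_ric opprK subrr //.
Qed.

Let Rm_H i j : dtr (fun k l => \sum_p dK p k i j * H l p) =
  \sum_b \sum_l \sum_p \sum_q driem i b j l * G b p * G l q * H p q.
Proof.
under [RHS]eq_bigr => b _ do rewrite exchange_big /=.
under [RHS]eq_bigr => b _ do under eq_bigr => p _ do rewrite exchange_big /=.
apply: eq_bigr => b _; apply: eq_bigr => p _.
rewrite mulr_sumr; apply: eq_bigr => q _.
rewrite dK_raise mulr_suml mulr_sumr; apply: eq_bigr => l _.
by rewrite (riemN_l i b) (riemN_r b i j l) opprK (GC l q); ring.
Qed.

Let tr_g w i : dtr (fun p q => g i p * w q) = w i.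
Proof.
rewrite -[RHS](sum_gG w); apply: eq_bigr => p _.
by rewrite mulr_sumr; apply: eq_bigr => q _; ring.
Qed.

(** The right side is symmetric in [i] and [j], so $Rc$ and $\nabla^2f$ commute; [lap_H] depends on
    this exchange. *)
Let dric_H i j :
  dtr (fun p q => dric i p * H q j) = mu * H i j - dtr (fun p q => H i p * H q j).
Proof.
rewrite (eq_dtr (fun p q => congr1 (fun x => x * H q j) (dricH i p))).
rewrite (eq_dtr (fun p q => mulrBl _ _ _)) dtrB; congr (_ - _).
rewrite -(tr_g (fun q => H q j)) -dtrMl; apply: eq_dtr => p q; ring.
Qed.

Let Fu_tr w : dtr (fun p q => w p * F q) = \sum_m w m * Fu m.
Proof.
apply: eq_bigr => p _; rewrite mulr_sumr; apply: eq_bigr => q _; ring.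
Qed.

(** By [T_comm] the sum is, up to sign, the curvature with $\nabla f$ in both slots of its
    antisymmetric last pair. *)
Let riem_FF i j : \sum_m (T i j m - T j i m) * Fu m = 0.
Proof.
under eq_bigr => m _ do rewrite T_comm dK_F mulNr mulr_suml.
rewrite sumrN; apply/eqP; rewrite oppr_eq0; apply/eqP; set z := \sum_m _.
have zN : z = - z.
  rewrite /z {1}exchange_big -sumrN; apply: eq_bigr => m _.
  by rewrite -sumrN; apply: eq_bigr => k _; rewrite riemN_r; ring.
by apply: double_inj; rewrite {1}zN addNr addr0.
Qed.

Let dcovK_F i j : - dtr (fun k l => \sum_p dcovK k p l i j * F p)
  = \sum_m (T m j i - T j m i) * Fu m.
Proof.
have e k l : \sum_p dcovK k p l i j * F p = - \sum_m dcovR k l i j m * Fu m.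
  rewrite -sumrN; under [RHS]eq_bigr => m _ do rewrite -mulNr -dcovRN_r mulr_suml.
  rewrite exchange_big /=; apply: eq_bigr => m _.
  rewrite -{1}(sum_gG F m) mulr_sumr; apply: eq_bigr => q _.
  by rewrite (gC q m) -/(Fu q); ring.
rewrite (eq_dtr e) dtrN opprK dtr_sum; apply: eq_bigr => m _.
by rewrite dtrMr div_dcovR.
Qed.

(** In $\nabla_k\nabla_l\nabla_i\nabla_jf$, traced over $k,l$, the index $i$ moves to the front past
    $l$ ([e1]) and past $k$ ([e2]), each exchange costing one $Rm(\nabla^2f,\cdot)$. What remains is
    $\nabla_i(\operatorname{div}\nabla^2f)_j=-\nabla_i(Rc(\nabla f))_j$ ([e3]), whose Ricci term
    cancels that of [e2]. The leftover third derivatives add up to $\nabla_{\nabla f}\nabla^2f$ by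
    [riem_FF]. *)
Let lap_H i j : dtr (fun k l => U k l i j) =
  dtr (fun k l => F k * T l i j)
  - (\sum_b \sum_l \sum_p \sum_q driem i b j l * G b p * G l q * H p q) *+ 2.
Proof.
rewrite -Rm_H; set RmH := (X in _ - X *+ 2).
have e1 : dtr (fun k l => U k l i j) - dtr (fun k l => U k i l j)
    = \sum_m (T m j i - T j m i) * Fu m - RmH.
  rewrite -dtrB (eq_dtr (fun k l => U_comm23 k l i j)) dtrB dtrN -dcovK_F.
  congr (_ - _).
  exact: (dtrC (fun k l => \sum_p dK p k i j * H l p)).
have e2 : dtr (fun k l => U k i l j) - dtr (fun k l => U i k l j)
    = dtr (fun p q => dric i p * H q j) - RmH.
  rewrite -dtrB (eq_dtr (fun k l => U_comm12 k i l j)) dtrN.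
  rewrite (eq_dtr (fun k l => big_split _ _ _ _ _)) /= dtrD opprD; congr (_ - _).
  rewrite dtr_sum -sumrN [RHS]exchange_big; apply: eq_bigr => p _ /=.
  rewrite dtrMr tr_dK mulNr opprK mulr_suml; apply: eq_bigr => q _.
  by rewrite (GC q p); ring.
have e3 : dtr (fun k l => U i k l j)
    = \sum_m T i j m * Fu m - dtr (fun p q => dric i p * H q j).
  rewrite -dcov1_contract -Fu_tr.
  have -> : dcov1 (fun j => dtr (fun k l => T k l j)) i j
      = - dcov1 (fun j => dtr (fun p q => dric j p * F q)) i j.
    rewrite /dcov1 -/(X j) X_ric derN opprD; congr (_ - _).
    by rewrite -sumrN; apply: eq_bigr => l _; rewrite -/(X l) X_ric mulrN.
  rewrite dcov1_dtr_mul dtrD opprD; congr (_ + _).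
    by rewrite -dtrN; apply: eq_dtr => p q; rewrite dcov2_dricT mulNr opprK.
  have -> : dtr (fun p q => dric j p * H i q) = dtr (fun p q => dric j p * H q i).
    by apply: eq_dtr => p q; rewrite (HC i).
  rewrite !dric_H HC; congr (- (_ - _)).
  by rewrite -dtrC; apply: eq_dtr => p q; rewrite (HC j) (HC p) mulrC.
have -> : dtr (fun k l => F k * T l i j)
    = \sum_m T m j i * Fu m + \sum_m (T i j m - T j i m) * Fu m.
  rewrite riem_FF addr0 -Fu_tr -dtrC; apply: eq_dtr => k l.
  by rewrite mulrC TC.
have -> : \sum_m (T i j m - T j i m) * Fu m
    = \sum_m T i j m * Fu m - \sum_m T j m i * Fu m.
  by rewrite -sumrB; apply: eq_bigr => m _; rewrite (TC j) mulrBl.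
rewrite -(subrK (dtr (fun k l => U k i l j)) (dtr (fun k l => U k l i j))) e1.
rewrite -(subrK (dtr (fun k l => U i k l j)) (dtr (fun k l => U k i l j))) e2 e3.
have -> : \sum_m (T m j i - T j m i) * Fu m
    = \sum_m T m j i * Fu m - \sum_m T j m i * Fu m.
  by rewrite -sumrB; apply: eq_bigr => m _; rewrite mulrBl.
rewrite mulr2n; ring.
Qed.

Let Rm_g i j : \sum_b \sum_l \sum_p \sum_q driem i b j l * G b p * G l q * g p q
  = dric i j.
Proof.
apply: eq_bigr => b _; apply: eq_bigr => l _.
rewrite -(sum_delta_r (fun p => driem i b j l * G b p) l); apply: eq_bigr => p _.
rewrite -gG mulr_sumr; apply: eq_bigr => q _.
by rewrite (GC q l); ring.
Qed.

(** With $Rc=\mu g-\nabla^2f$, [lap_H] gives $\frac12\Delta_fRc=Rm(\nabla^2f,\cdot)$, while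
    $Rm(Rc,\cdot)=\mu Rc-Rm(\nabla^2f,\cdot)$ because $Rm(g,\cdot)=Rc$. *)
Lemma Lf_ric i j :
  half * (\sum_k \sum_l
            G k l * (dcov3 (dcov2 dric) k l i j - F k * dcov2 dric l i j))
  + \sum_b \sum_l \sum_p \sum_q driem i b j l * G b p * G l q * dric p q
  = mu * dric i j.
Proof.
have -> : \sum_b \sum_l \sum_p \sum_q driem i b j l * G b p * G l q * dric p q
   = mu * dric i j
     - \sum_b \sum_l \sum_p \sum_q driem i b j l * G b p * G l q * H p q.
  rewrite -{1}Rm_g mulr_sumr -sumrB; apply: eq_bigr => b _.
  rewrite mulr_sumr -sumrB; apply: eq_bigr => l _.
  rewrite mulr_sumr -sumrB; apply: eq_bigr => p _.
  rewrite mulr_sumr -sumrB; apply: eq_bigr => q _.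
  by rewrite dricH; ring.
rewrite -/(dtr (fun k l => dcov3 (dcov2 dric) k l i j - F k * dcov2 dric l i j)).
rewrite (eq_dtr (h' := fun k l => F k * T l i j - U k l i j)); last first.
  move=> k l; rewrite dcov2_dricT mulrN opprK addrC; congr (_ + _).
  rewrite (dcov3_ext _ _ _ _ dcov2_dricT) /dcov3 derN opprB [RHS]addrC.
  congr (_ + _); rewrite -sumrN; apply: eq_bigr => p _; ring.
rewrite dtrB lap_H; set z := \sum_b _.
by rewrite subKr mulr2n mulrDr -mulrDl half2 mul1r addrC subrK.
Qed.

End DifferentialRing.

(** * Functions with continuous partial derivatives *)

Section PartialDerivatives.
Context {R : realType} {n : nat}.
Local Notation E := 'rV[R]_n.
Implicit Types (u v : E -> R) (V W : set E) (x y : E) (i j : 'I_n) (k : nat).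

Local Notation pdable u x := (forall i : 'I_n, derivable u x (delta_mx 0 i)).

Lemma pd_near_eq i u v x : (\forall y \near x, u y = v y) -> pd i u x = pd i v x.
Proof. exact: near_eq_derive. Qed.

Lemma near_open V x (P : E -> Prop) : open V -> V x ->
  (forall y, V y -> P y) -> \forall y \near x, P y.
Proof.
by move=> Vo Vx VP; exact: filterS VP (open_nbhs_nbhs (conj Vo Vx)).
Qed.

Lemma pd_eq_on V i u v x : open V -> V x -> (forall y, V y -> u y = v y) ->
  pd i u x = pd i v x.
Proof. by move=> Vo Vx e; apply: pd_near_eq; exact: near_open e. Qed.

Lemma pd_cst i (c : R) x : pd i (fun=> c) x = 0.
Proof. exact: derive_cst. Qed.

Lemma pdD i u v x : derivable u x (delta_mx 0 i) -> derivable v x (delta_mx 0 i) ->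
  pd i (fun y => u y + v y) x = pd i u x + pd i v x.
Proof. exact: deriveD. Qed.

Lemma pdM i u v x : derivable u x (delta_mx 0 i) -> derivable v x (delta_mx 0 i) ->
  pd i (fun y => u y * v y) x = pd i u x * v x + u x * pd i v x.
Proof.
move=> du dv.
have -> : pd i (fun y => u y * v y) x = u x *: pd i v x + v x *: pd i u x.
  exact: deriveM.
by rewrite addrC [v x *: _]mulrC.
Qed.

Lemma pdV i u x : u x != 0 -> derivable u x (delta_mx 0 i) ->
  pd i (fun y => (u y)^-1) x = - (u x)^-1 * (u x)^-1 * pd i u x.
Proof.
move=> u0 du; rewrite /pd deriveV // /GRing.scale /=.
by rewrite expr2 invfM !mulNr.
Qed.

Lemma Ck_on_ext k V u v : open V -> (forall x, V x -> u x = v x) ->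
  Ck_on k V u -> Ck_on k V v.
Proof.
have cont u' v' x : open V -> V x -> (forall x, V x -> u' x = v' x) ->
    {for x, continuous u'} -> {for x, continuous v'}.
  move=> Vo Vx e; rewrite /prop_for /continuous_at -(e x Vx).
  have eN : {near x, u' =1 v'} by exact: near_open e.
  by move=> cu; exact: cvg_trans (near_eq_cvg eN) cu.
move=> Vo; elim: k u v => [|k IH] u v e /= [cu Cu].
  by split=> // x Vx; apply: cont (cu x Vx).
split=> [x Vx|i]; first by apply: cont (cu x Vx).
have [du Cu'] := Cu i; split.
  by move=> x Vx; apply: near_eq_derivable (du x Vx); exact: near_open e.
by apply: IH Cu' => x Vx; exact: pd_eq_on e.
Qed.

Lemma Ck_onW k V u : Ck_on k.+1 V u -> Ck_on k V u.
Proof.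
elim: k u => [|k IH] u; first by case.
move=> [cu Cu]; split=> // i; have [du Cu'] := Cu i.
by split=> //; exact: IH.
Qed.

Lemma Ck_on_cst k V (c : R) : Ck_on k V (fun=> c).
Proof.
elim: k c => [|k IH] c; first by split=> // x _; exact: cst_continuous.
split=> [x _|i]; first exact: cst_continuous.
split=> [x _|]; first exact: derivable_cst.
have -> : pd i (fun=> c) = fun=> 0 by apply/funext => x; rewrite pd_cst.
exact: IH.
Qed.

Lemma Ck_onD k V u v : open V -> Ck_on k V u -> Ck_on k V v ->
  Ck_on k V (fun x => u x + v x).
Proof.
move=> Vo; elim: k u v => [|k IH] u v [cu Cu] [cv Cv].
  by split=> // x Vx; apply: (@continuousD _ _ _ u v x); [exact: cu | exact: cv].
split=> [x Vx|i]; first by apply: (@continuousD _ _ _ u v x); [exact: cu | exact: cv].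
have [du Cu'] := Cu i; have [dv Cv'] := Cv i.
split=> [x Vx|]; first by apply: derivableD; [exact: du | exact: dv].
apply: Ck_on_ext (IH _ _ Cu' Cv') => // x Vx.
by rewrite pdD //; [exact: du | exact: dv].
Qed.

Lemma Ck_onM k V u v : open V -> Ck_on k V u -> Ck_on k V v ->
  Ck_on k V (fun x => u x * v x).
Proof.
move=> Vo; elim: k u v => [|k IH] u v Cu Cv.
  by split=> // x Vx; apply: (@continuousM _ _ u v x); [exact: Cu.1 | exact: Cv.1].
split=> [x Vx|i]; first by apply: (@continuousM _ _ u v x); [exact: Cu.1 | exact: Cv.1].
have [du Cu'] := Cu.2 i; have [dv Cv'] := Cv.2 i.
split=> [x Vx|]; first by apply: derivableM; [exact: du | exact: dv].
have := Ck_onD Vo (IH _ _ Cu' (Ck_onW Cv)) (IH _ _ (Ck_onW Cu) Cv').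
apply: Ck_on_ext => // x Vx.
by rewrite pdM //; [exact: du | exact: dv].
Qed.

Lemma Ck_onV k V u : open V -> (forall x, V x -> u x != 0) -> Ck_on k V u ->
  Ck_on k V (fun x => (u x)^-1).
Proof.
move=> Vo u0; elim: k => [|k IH] Cu.
  by split=> // x Vx; apply: (@continuousV _ _ u x); [exact: u0 | exact: Cu.1].
split=> [x Vx|i]; first by apply: (@continuousV _ _ u x); [exact: u0 | exact: Cu.1].
have [du Cu'] := Cu.2 i.
split=> [x Vx|]; first by apply: derivableV; [exact: u0 | exact: du].
have Ck := IH (Ck_onW Cu).
have := Ck_onM Vo (Ck_on_cst k V (-1)) (Ck_onM Vo (Ck_onM Vo Ck Ck) Cu').
apply: Ck_on_ext => // x Vx.
by rewrite pdV ?u0 //; [rewrite mulN1r !mulNr | exact: du].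
Qed.

Lemma smooth_ext V u v : open V -> (forall x, V x -> u x = v x) ->
  smooth_on V u -> smooth_on V v.
Proof. by move=> Vo e su k; exact: Ck_on_ext e (su k). Qed.

Lemma smooth_cst V (c : R) : smooth_on V (fun=> c).
Proof. by move=> k; exact: Ck_on_cst. Qed.

Lemma smoothD V u v : open V -> smooth_on V u -> smooth_on V v ->
  smooth_on V (fun x => u x + v x).
Proof. by move=> Vo su sv k; exact: Ck_onD. Qed.

Lemma smoothM V u v : open V -> smooth_on V u -> smooth_on V v ->
  smooth_on V (fun x => u x * v x).
Proof. by move=> Vo su sv k; exact: Ck_onM. Qed.

Lemma smoothV V u : open V -> (forall x, V x -> u x != 0) -> smooth_on V u ->
  smooth_on V (fun x => (u x)^-1).
Proof. by move=> Vo u0 su k; exact: Ck_onV. Qed.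

Lemma smoothN V u : open V -> smooth_on V u -> smooth_on V (fun x => - u x).
Proof.
move=> Vo su; apply: smooth_ext (smoothM Vo (smooth_cst V (-1)) su) => // x _.
by rewrite mulN1r.
Qed.

Lemma smooth_sum (I : Type) (r : seq I) (P : pred I) V (F : I -> E -> R) :
  open V -> (forall l, P l -> smooth_on V (F l)) ->
  smooth_on V (fun x => \sum_(l <- r | P l) F l x).
Proof.
move=> Vo sF; elim: r => [|l r IH].
  by apply: smooth_ext (smooth_cst V 0) => // x _; rewrite big_nil.
case Pl: (P l).
  by apply: smooth_ext (smoothD Vo (sF l Pl) IH) => // x _; rewrite big_cons Pl.
by apply: smooth_ext IH => // x _; rewrite big_cons Pl.
Qed.

Lemma smooth_prod (I : Type) (r : seq I) V (F : I -> E -> R) :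
  open V -> (forall l, smooth_on V (F l)) ->
  smooth_on V (fun x => \prod_(l <- r) F l x).
Proof.
move=> Vo sF; elim: r => [|l r IH].
  by apply: smooth_ext (smooth_cst V 1) => // x _; rewrite big_nil.
by apply: smooth_ext (smoothM Vo (sF l) IH) => // x _; rewrite big_cons.
Qed.

Lemma smooth_pd V u i : smooth_on V u -> smooth_on V (pd i u).
Proof. by move=> su k; exact: ((su k.+1).2 i).2. Qed.

Lemma smooth_continuous V u x : smooth_on V u -> V x -> {for x, continuous u}.
Proof. by move=> su; exact: (su 0%N).1. Qed.

Lemma smooth_derivable V u x i : smooth_on V u -> V x ->
  derivable u x (delta_mx 0 i).
Proof. by move=> su Vx; exact: ((su 1%N).2 i).1. Qed.

Lemma smooth_det V m (F : E -> 'M[R]_m) : open V ->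
  (forall i j : 'I_m, smooth_on V (fun x => F x i j)) ->
  smooth_on V (fun x => \det (F x)).
Proof.
move=> Vo sF; apply: smooth_sum => // s _.
by apply: smoothM => //; [exact: smooth_cst | exact: smooth_prod].
Qed.

(** Cramer's rule: the cofactors are determinants, and the determinant has no zero on [V]. *)
Lemma smooth_invmx V m (F : E -> 'M[R]_m) : open V ->
  (forall x, V x -> F x \in unitmx) ->
  (forall i j : 'I_m, smooth_on V (fun x => F x i j)) ->
  forall i j : 'I_m, smooth_on V (fun x => invmx (F x) i j).
Proof.
move=> Vo uF sF i j.
have sdet := smooth_det Vo sF.
have sV : smooth_on V (fun x => (\det (F x))^-1).
  by apply: smoothV => // x Vx; rewrite -unitfE -unitmxE uF.
suff sadj : smooth_on V (fun x => (\adj (F x)) i j).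
  apply: smooth_ext (smoothM Vo sV sadj) => // x Vx.
  by rewrite /invmx uF // [RHS]mxE.
have : smooth_on V (fun x => (-1) ^+ (j + i) * \det (row' j (col' i (F x)))).
  apply: smoothM => //; first exact: smooth_cst.
  apply: smooth_det => // k l; apply: smooth_ext (sF (lift j k) (lift i l)) => //.
  by move=> x _; rewrite !mxE.
by apply: smooth_ext => // x _; rewrite mxE.
Qed.

End PartialDerivatives.

Lemma near_eq_cvg_to (T : Type) (U : topologicalType) (F : set_system T)
  {FF : Filter F} (f g : T -> U) (l : U) :
  (\forall x \near F, f x = g x) -> f @ F --> l -> g @ F --> l.
Proof. by move=> e; apply: cvg_trans; exact: near_eq_cvg. Qed.

Section LineDerivatives.
Context {R : realType} {n : nat}.
Local Notation E := 'rV[R]_n.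
Implicit Types (u : E -> R) (V : set E) (x y v : E) (i j : 'I_n) (s t : R).

Lemma is_derive_line u y v t : derivable u (y + t *: v) v ->
  is_derive t (1 : R) (fun t : R => u (y + t *: v)) ('D_v u (y + t *: v)).
Proof.
move=> du.
have e : (fun h : R => h^-1 *: (((fun t : R => u (y + t *: v)) \o shift t) (h *: (1 : R))
           - u (y + t *: v)))
       = (fun h : R => h^-1 *: ((u \o shift (y + t *: v)) (h *: v) - u (y + t *: v))).
  apply/funext => h /=; congr (_ *: (u _ - _)).
  by rewrite [_ *: 1]mulr1 scalerDl addrCA.
by apply: DeriveDef; rewrite /derivable /derive e.
Qed.

(** Parametrising the segment by $[0,1]$ treats [s] of either sign, and zero, at once. *)
Lemma line_MVT u y v s :
  (forall t, 0 <= t <= 1 -> derivable u (y + (t * s) *: v) v) ->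
  exists t, 0 < t < 1 /\
    u (y + s *: v) - u y = s * 'D_v u (y + (t * s) *: v).
Proof.
move=> du.
have df t : 0 <= t <= 1 ->
    is_derive t (1 : R) (fun t => u (y + (t * s) *: v)) ('D_v u (y + (t * s) *: v) * s).
  move=> t01; apply: (@is_derive1_comp _ (fun t => u (y + t *: v)) (fun t => t * s)).
    by apply: is_derive_line; exact: du.
  have -> : (fun t => t * s) = s *: (id : R -> R) by apply/funext => t'; rewrite mulrC.
  by apply: is_derive_eq; rewrite [_ *: _]mulr1.
have dfo t : t \in `]0, 1[%R ->
    is_derive t (1 : R) (fun t => u (y + (t * s) *: v)) ('D_v u (y + (t * s) *: v) * s).
  by rewrite in_itv /= => /andP[/ltW t0 /ltW t1]; apply: df; rewrite t0 t1.
have cf : {within `[0, 1], continuous (fun t => u (y + (t * s) *: v))}.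
  apply: derivable_within_continuous => t; rewrite in_itv /= => t01.
  exact: (@ex_derive _ _ _ _ _ _ _ (df t t01)).
have [c] := MVT ltr01 dfo cf.
rewrite in_itv /= mul1r mul0r scale0r addr0 subr0 mulr1 => c01 e.
by exists c; split=> //; rewrite e mulrC.
Qed.

Lemma rV_norm_le x (r : R) : 0 <= r -> (forall i, `|x 0 i| <= r) -> `|x| <= r.
Proof.
move=> r0 xr; rewrite /Num.Def.normr /= mx_normrE; apply/bigmax_leP; split=> //.
by move=> [a b] _ /=; rewrite (ord1 a).
Qed.

Lemma rV_coord_le x i : `|x 0 i| <= `|x|.
Proof.
rewrite [leRHS]/Num.Def.normr /= mx_normrE.
exact: (le_bigmax _ (fun ij : 'I_1 * 'I_n => `|x ij.1 ij.2|) (0, i)).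
Qed.

Lemma norm_delta_le i : `|delta_mx 0 i : E| <= 1.
Proof.
apply: rV_norm_le => // j; rewrite mxE /=; case: (_ == _) => /=; rewrite ?normr1 ?normr0 //.
Qed.

Lemma open_ball_sub V x : open V -> V x ->
  exists2 r, 0 < r & forall y, `|y - x| < r -> V y.
Proof.
move=> Vo Vx; have /nbhs_ballP[r r0 rV] := open_nbhs_nbhs (conj Vo Vx).
exists r => // y yx; apply: rV; rewrite -ball_normE /ball_ /= distrC //.
Qed.

(** A path from [x] to [y] changes one coordinate at a time, [z m] having the first [m] coordinates
    of [y]; the mean value theorem is applied on each edge. In the maximum norm all edges stay in
    the closed ball around [x] through [y]. *)
Lemma increment_expansion u x y :
  (forall z, `|z - x| <= `|y - x| -> forall i, derivable u z (delta_mx 0 i)) ->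
  exists xi : 'I_n -> E, (forall k, `|xi k - x| <= `|y - x|) /\
    u y - u x = \sum_k (y 0 k - x 0 k) * pd k u (xi k).
Proof.
move=> du; pose z m : E := \row_j (if (j < m)%N then y 0 j else x 0 j).
pose d k := y 0 k - x 0 k.
have zS (k : 'I_n) : z k.+1 = z k + d k *: delta_mx 0 k.
  apply/rowP => j; rewrite !mxE eqxx /= ltnS leq_eqVlt.
  have [->|jk] := eqVneq j k; first by rewrite eqxx ltnn mulr1 subrKC.
  by rewrite (inj_eq val_inj) (negbTE jk) mulr0 addr0.
have zle (k : 'I_n) (t : R) : 0 <= t <= 1 ->
    `|z k + (t * d k) *: delta_mx 0 k - x| <= `|y - x|.
  move=> /andP[t0 t1]; apply: rV_norm_le => // j; rewrite !mxE eqxx /=.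
  have := rV_coord_le (y - x) j; rewrite !mxE => dj.
  have [->|jk] := eqVneq j k.
    rewrite ltnn mulr1 addrAC subrr add0r normrM ger0_norm //.
    by have := rV_coord_le (y - x) k; rewrite !mxE; apply: le_trans; rewrite ler_piMl.
  by rewrite mulr0 addr0; case: ifP => // _; rewrite subrr normr0.
have ex (k : 'I_n) : exists w, `|w - x| <= `|y - x| /\
    u (z k.+1) - u (z k) = d k * pd k u w.
  have [|t [t01 e]] := @line_MVT u (z k) (delta_mx 0 k) (d k).
    by move=> t t01; apply: du; exact: zle.
  have {}t01 : 0 <= t <= 1 by case/andP: t01 => /ltW -> /ltW ->.
  by exists (z k + (t * d k) *: delta_mx 0 k); rewrite zS; split=> //; exact: zle.
have [xi xiP] := choice ex; exists xi; split=> [k|]; first exact: (xiP k).1.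
have <- : z n = y by apply/rowP => j; rewrite mxE ltn_ord.
have <- : z 0%N = x by apply/rowP => j; rewrite mxE.
rewrite -(@telescope_sumr _ 0 n (fun k => u (z k))) // big_mkord.
apply: eq_bigr => k _; rewrite (xiP k).2; congr (_ * _).
by rewrite !mxE ltn_ord.
Qed.

(** The difference quotient is a sum of coordinate quotients times partial derivatives at
    intermediate points; these points tend to [phi p], where the partial derivatives are
    continuous. *)
Lemma is_derive_chain (W : normedModType R) (phi : W -> E) (p w : W) u V :
  open V -> V (phi p) ->
  (forall z, V z -> forall i, derivable u z (delta_mx 0 i)) ->
  (forall i, {for phi p, continuous (pd i u)}) ->
  (forall k, derivable (fun q => phi q 0 k) p w) ->
  is_derive p w (u \o phi)
    (\sum_k 'D_w (fun q => phi q 0 k) p * pd k u (phi p)).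
Proof.
move=> Vo Vp du cu dphi; have [r r0 rV] := open_ball_sub Vo Vp.
pose ph (h : R) := phi (h *: w + p).
have ex h : exists xi : 'I_n -> E, (forall k, `|xi k - phi p| <= `|ph h - phi p|) /\
    (`|ph h - phi p| < r ->
     u (ph h) - u (phi p) = \sum_k (ph h 0 k - phi p 0 k) * pd k u (xi k)).
  have [hr|hr] := ltP `|ph h - phi p| r; last first.
    (* A default value far from [phi p]: it respects the bound on [xi], so that [choice] yields
       points for every [h]. *)
    exists (fun=> phi p); split=> [k|//]; first by rewrite subrr normr0.
  have [|xi [xi1 xi2]] := @increment_expansion u (phi p) (ph h).
    by move=> z zr; apply: du; apply: rV; exact: le_lt_trans zr hr.
  by exists xi.
have [xi xiP] := choice ex.
have cvk k : (fun h => h^-1 *: (ph h 0 k - phi p 0 k)) @ 0^' --> 'D_w (fun q => phi q 0 k) p.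
  exact: dphi.
have cvph : (fun h => ph h) @ 0^' --> phi p.
  apply/cvgrPdist_lt => e e0.
  have c k : (fun h : R => ph h 0 k) @ 0^' --> phi p 0 k.
    have -> : (fun h : R => ph h 0 k)
        = (fun h => phi p 0 k + (ph h 0 k - phi p 0 k)).
      by apply/funext => h; rewrite addrC subrK.
    rewrite -[X in _ --> X]addr0; apply: cvgD; first exact: cvg_cst.
    (* The coordinate is continuous along the line, its increment being [h] times a convergent
       quotient. *)
    rewrite -[X in _ --> X](mul0r ('D_w (fun q => phi q 0 k) p)).
    have : (fun h : R => h * (h^-1 *: (ph h 0 k - phi p 0 k))) @ 0^'
        --> 0 * 'D_w (fun q => phi q 0 k) p.
      have id0 : (fun h : R => h) @ (0 : R)^' --> (0 : R).
        by move=> B B0; exact: nbhs_dnbhs.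
      exact: cvgM id0 (cvk k).
    apply: near_eq_cvg_to; near=> h.
    rewrite [_ *: _]/(_ * _) mulrA divff ?mul1r //.
    by near: h; exact: nbhs_dnbhs_neq.
  have all : \forall h \near 0^', forall k, `|phi p 0 k - ph h 0 k| < e / 2.
    apply: filter_forall => k.
    by move/cvgrPdist_lt : (c k); apply; rewrite divr_gt0.
  apply: filterS all => h hk; apply: (@le_lt_trans _ _ (e / 2)); last first.
    by rewrite ltr_pdivrMr // ltr_pMr // ltr1n.
  apply: rV_norm_le => [|k]; first by rewrite divr_ge0 // ltW.
  by rewrite !mxE; apply: ltW; exact: hk.
have cxi k : (fun h => xi h k) @ 0^' --> phi p.
  apply/cvgrPdist_lt => e e0.
  have /cvgrPdist_lt/(_ e e0) := cvph.
  apply: filterS => h; rewrite distrC [X in _ -> X < _]distrC.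
  by apply: le_lt_trans; exact: (xiP h).1.
have lim : (fun h => h^-1 *: ((u \o phi) (h *: w + p) - (u \o phi) p)) @ 0^' -->
    \sum_k 'D_w (fun q => phi q 0 k) p * pd k u (phi p).
  have : (fun h => \sum_k (h^-1 *: (ph h 0 k - phi p 0 k)) * pd k u (xi h k)) @ 0^' -->
      \sum_k 'D_w (fun q => phi q 0 k) p * pd k u (phi p).
    apply: cvg_big => [|k _]; first exact: add_continuous.
    apply: cvgM; first exact: cvk.
    exact: (cvg_comp _ _ (cxi k) (cu k)).
  apply: near_eq_cvg_to; near=> h.
  have hr : `|ph h - phi p| < r.
    rewrite distrC; near: h.
    by move/cvgrPdist_lt : cvph; exact.
  rewrite /= -/(ph h) ((xiP h).2 hr) scaler_sumr; apply: eq_bigr => k _.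
  by rewrite scalerAl.
apply: DeriveDef; first by apply/cvg_ex; eexists; exact: lim.
exact: cvg_lim lim.
Unshelve. all: by end_near. Qed.

End LineDerivatives.

Section MixedPartials.
Context {R : realType} {n : nat}.
Local Notation E := 'rV[R]_n.
Implicit Types (u : E -> R) (V : set E) (x y v : E) (i j : 'I_n) (s t : R).

Lemma is_derive_translate u y v c : derivable u (y + c) v ->
  is_derive y v (fun z => u (z + c)) ('D_v u (y + c)).
Proof.
move=> du.
have e : (fun h : R => h^-1 *: (((fun z => u (z + c)) \o shift y) (h *: v) - u (y + c)))
       = (fun h : R => h^-1 *: ((u \o shift (y + c)) (h *: v) - u (y + c))).
  by apply/funext => h /=; rewrite addrA.
by apply: DeriveDef; rewrite /derivable /derive e.
Qed.

(** The mean value theorem is used twice: in direction $e_i$ for $z\mapsto u(z+se_j)-u(z)$, then in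
    direction $e_j$ for $\partial_iu$. *)
Lemma second_difference V u x r s i j : smooth_on V u -> 0 < s ->
  (forall y, `|y - x| < r -> V y) -> s + s < r ->
  exists y, `|y - x| <= s + s /\
    u (x + s *: delta_mx 0 i + s *: delta_mx 0 j) - u (x + s *: delta_mx 0 i)
    - (u (x + s *: delta_mx 0 j) - u x) = s * s * pd j (pd i u) y.
Proof.
move=> su s0 rV ssr; set ei := delta_mx 0 i : E; set ej := delta_mx 0 j : E.
have ne (a b : R) : 0 <= a <= 1 -> 0 <= b <= 1 ->
    `|x + (a * s) *: ei + (b * s) *: ej - x| <= s + s.
  move=> /andP[a0 a1] /andP[b0 b1].
  rewrite addrAC [x + _ - x]addrAC subrr add0r addrC; apply: le_trans (ler_normD _ _) _.
  apply: lerD; rewrite normrZ normrM !ger0_norm ?(ltW s0) //.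
    rewrite -[leRHS]mulr1; apply: ler_pM; rewrite ?normr_ge0 ?mulr_ge0 ?(ltW s0) //.
      by rewrite ler_piMl // ltW.
    exact: norm_delta_le.
  rewrite -[leRHS]mulr1; apply: ler_pM; rewrite ?normr_ge0 ?mulr_ge0 ?(ltW s0) //.
    by rewrite ler_piMl // ltW.
  exact: norm_delta_le.
have inV a b : 0 <= a <= 1 -> 0 <= b <= 1 -> V (x + (a * s) *: ei + (b * s) *: ej).
  by move=> a01 b01; apply: rV; exact: le_lt_trans (ne a b a01 b01) ssr.
have i0 : 0 <= (0 : R) <= 1 by rewrite lexx ler01.
have i1 : 0 <= (1 : R) <= 1 by rewrite lexx ler01.
have inV0 a : 0 <= a <= 1 -> V (x + (a * s) *: ei).
  by move=> a01; have := inV a 0 a01 i0; rewrite mul0r scale0r addr0.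
have inV1 a : 0 <= a <= 1 -> V (x + (a * s) *: ei + s *: ej).
  by move=> a01; have := inV a 1 a01 i1; rewrite mul1r.
have dphi a : 0 <= a <= 1 ->
    is_derive (x + (a * s) *: ei) ei (fun z => u (z + s *: ej) - u z)
      (pd i u (x + (a * s) *: ei + s *: ej) - pd i u (x + (a * s) *: ei)).
  move=> a01; apply: (@is_deriveB _ _ _ (fun z => u (z + s *: ej)) u).
    by apply: is_derive_translate; apply: smooth_derivable su _; exact: inV1.
  by apply: derivableP; apply: smooth_derivable su _; exact: inV0.
have [a a01|a [a01 ea]] := @line_MVT _ _ (fun z => u (z + s *: ej) - u z) x ei s.
  exact: (@ex_derive _ _ _ _ _ _ _ (dphi a a01)).
have {}a01 : 0 <= a <= 1 by case/andP: a01 => /ltW -> /ltW ->.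
have [b b01|b [b01 eb]] := @line_MVT _ _ (pd i u) (x + (a * s) *: ei) ej s.
  by apply: smooth_derivable (smooth_pd i su) _; exact: inV.
have {}b01 : 0 <= b <= 1 by case/andP: b01 => /ltW -> /ltW ->.
exists (x + (a * s) *: ei + (b * s) *: ej); split; first exact: ne.
rewrite ea -mulrA; congr (_ * _); rewrite -eb.
by rewrite (@derive_val _ _ _ _ _ _ _ (dphi a a01)).
Qed.

Let quarter_lt (m : R) : 0 < m -> m / 4 + m / 4 < m.
Proof. by move=> m0; lra. Qed.

(** The second difference is symmetric in [i] and [j], so the two mixed partials take a common value
    at points arbitrarily close to [x], and by continuity they agree at [x]. *)
Lemma pdC V u x i j : open V -> smooth_on V u -> V x ->
  pd i (pd j u) x = pd j (pd i u) x.
Proof.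
move=> Vo su Vx; have [r r0 rV] := open_ball_sub Vo Vx.
apply/eqP; apply/negP => /negP ne.
pose A := pd i (pd j u); pose B := pd j (pd i u).
(* Half the supposed gap: two deviations below [e] cannot bridge it. *)
pose e := `|A x - B x| / 2.
have e0 : 0 < e by rewrite divr_gt0 // normr_gt0 subr_eq0.
have cA : {for x, continuous A}.
  exact: smooth_continuous (smooth_pd i (smooth_pd j su)) Vx.
have cB : {for x, continuous B}.
  exact: smooth_continuous (smooth_pd j (smooth_pd i su)) Vx.
have [d d0 dP] : exists2 d : R, 0 < d &
    forall y, `|y - x| < d -> `|A x - A y| < e /\ `|B x - B y| < e.
  have /cvgrPdist_lt/(_ e e0) nA := cA; have /cvgrPdist_lt/(_ e e0) nB := cB.
  have nAB : nbhs x [set y | `|A x - A y| < e /\ `|B x - B y| < e].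
    exact: filterI nA nB.
  have /nbhs_ballP[d d0 dP] := nAB.
  by exists d => // y yx; apply: dP; rewrite -ball_normE /ball_ /= distrC.
pose s := Num.min r d / 4.
have s0 : 0 < s by rewrite divr_gt0 // lt_min r0.
have ss : s + s < Num.min r d.
  by apply: quarter_lt; rewrite lt_min r0.
have ssr : s + s < r by apply: lt_le_trans ss _; rewrite ge_min lexx.
have ssd : s + s < d by apply: lt_le_trans ss _; rewrite ge_min lexx orbT.
have [y [yx ey]] := second_difference i j su s0 rV ssr.
have [z [zx ez]] := second_difference j i su s0 rV ssr.
have AB : A z = B y.
  apply: (@mulfI _ (s * s)); first by rewrite mulf_neq0 // gt_eqF.
  rewrite -[LHS]ez -[RHS]ey.
  by rewrite [x + _ + _]addrAC opprB opprB; ring.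
have [A1 _] := dP z (le_lt_trans zx ssd); have [_ B1] := dP y (le_lt_trans yx ssd).
have : `|A x - B x| < e + e.
  have q (a b c : R) : a - b = (a - c) - (b - c) by ring.
  rewrite (q (A x) (B x) (A z)) {2}AB.
  exact: le_lt_trans (ler_normB _ _) (ltrD A1 B1).
by rewrite /e -splitr ltxx.
Qed.

Lemma pd_comp (m : nat) (V : set E) (W : set 'rV[R]_m) (phi : 'rV[R]_m -> E) u
    (p : 'rV[R]_m) (a : 'I_m) :
  open V -> V (phi p) -> smooth_on V u -> W p ->
  (forall k, smooth_on W (fun q => phi q 0 k)) ->
  is_derive p (delta_mx 0 a) (u \o phi)
    (\sum_k pd a (fun q => phi q 0 k) p * pd k u (phi p)).
Proof.
move=> Vo Vp su Wp sphi.
have cu i : {for phi p, continuous (pd i u)}.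
  exact: smooth_continuous (smooth_pd i su) Vp.
have du z : V z -> forall i, derivable u z (delta_mx 0 i).
  by move=> Vz i; exact: smooth_derivable su Vz.
apply: (is_derive_chain Vo Vp du cu) => k.
exact: smooth_derivable (sphi k) Wp.
Qed.

End MixedPartials.

(** * The differential ring of smooth functions *)

(* Setting the value to 0 off V makes equality of these functions the same as
   equality on V. *)
Record smooth_fun_on (R : realType) (n : nat) (V : set 'rV[R]_n) (Vo : open V) :=
  SmoothFunOn {
    smooth_val :> 'rV[R]_n -> R;
    smooth_valP : smooth_on V smooth_val;
    smooth_val_out : forall x, ~ V x -> smooth_val x = 0 }.

Section SmoothRing.
Context {R : realType} {n : nat} {V : set 'rV[R]_n} (Vo : open V).
Local Notation A := (smooth_fun_on Vo).
Implicit Types (u v : 'rV[R]_n -> R) (a b c : A) (i j : 'I_n).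

HB.instance Definition _ := gen_eqMixin A.
HB.instance Definition _ := gen_choiceMixin A.

Definition cut u : 'rV[R]_n -> R := fun x => if `[< V x >] then u x else 0.

Lemma cut_in u x : V x -> cut u x = u x.
Proof. by move=> Vx; rewrite /cut asboolT. Qed.

Lemma cut_out u x : ~ V x -> cut u x = 0.
Proof. by move=> Vx; rewrite /cut asboolF. Qed.

Lemma smooth_cut u : smooth_on V u -> smooth_on V (cut u).
Proof. by apply: smooth_ext => // x Vx; rewrite cut_in. Qed.

Definition to_smooth u (su : smooth_on V u) : A :=
  SmoothFunOn Vo (smooth_cut su) (cut_out u).

Lemma smooth_fun_eq a b : (forall x, V x -> a x = b x) -> a = b.
Proof.
case: a => a sa a0; case: b => b sb b0 /= ab.
have e : a = b.
  apply/funext => x; have [Vx|Vx] := pselect (V x); first exact: ab.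
  by rewrite a0 // b0.
by move: sa a0; rewrite e => sa a0; congr SmoothFunOn; exact: Prop_irrelevance.
Qed.

Definition sf_cst (r : R) : A := to_smooth (smooth_cst V r).
Definition sf_add a b : A := to_smooth (smoothD Vo (smooth_valP a) (smooth_valP b)).
Definition sf_opp a : A := to_smooth (smoothN Vo (smooth_valP a)).
Definition sf_mul a b : A := to_smooth (smoothM Vo (smooth_valP a) (smooth_valP b)).
Definition sf_pd i a : A := to_smooth (smooth_pd i (smooth_valP a)).

Lemma sf_addA : associative sf_add.
Proof.
by move=> a b c; apply: smooth_fun_eq => x Vx; rewrite /= !cut_in //= ?cut_in // addrA.
Qed.

Lemma sf_addC : commutative sf_add.
Proof. by move=> a b; apply: smooth_fun_eq => x Vx; rewrite /= !cut_in // addrC. Qed.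

Lemma sf_add0 : left_id (sf_cst 0) sf_add.
Proof. by move=> a; apply: smooth_fun_eq => x Vx; rewrite /= !cut_in // add0r. Qed.

Lemma sf_addN : left_inverse (sf_cst 0) sf_opp sf_add.
Proof. by move=> a; apply: smooth_fun_eq => x Vx; rewrite /= !cut_in // addNr. Qed.

HB.instance Definition _ := GRing.isZmodule.Build A sf_addA sf_addC sf_add0 sf_addN.

Lemma sf_mulA : associative sf_mul.
Proof.
by move=> a b c; apply: smooth_fun_eq => x Vx; rewrite /= !cut_in //= ?cut_in // mulrA.
Qed.

Lemma sf_mulC : commutative sf_mul.
Proof. by move=> a b; apply: smooth_fun_eq => x Vx; rewrite /= !cut_in // mulrC. Qed.

Lemma sf_mul1 : left_id (sf_cst 1) sf_mul.
Proof. by move=> a; apply: smooth_fun_eq => x Vx; rewrite /= !cut_in // mul1r. Qed.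

Lemma sf_mulDl : left_distributive sf_mul +%R.
Proof.
by move=> a b c; apply: smooth_fun_eq => x Vx; rewrite /= !cut_in //= ?cut_in // mulrDl.
Qed.

HB.instance Definition _ :=
  GRing.Zmodule_isComPzRing.Build A sf_mulA sf_mulC sf_mul1 sf_mulDl.

Section Evaluation.
Context {x : 'rV[R]_n} (Vx : V x).

Lemma sfD a b : (a + b) x = a x + b x. Proof. exact: cut_in. Qed.
Lemma sfN a : (- a) x = - a x. Proof. exact: cut_in. Qed.
Lemma sfB a b : (a - b) x = a x - b x. Proof. by rewrite sfD sfN. Qed.
Lemma sfM a b : (a * b) x = a x * b x. Proof. exact: cut_in. Qed.
Lemma sf0 : (0 : A) x = 0. Proof. exact: cut_in. Qed.
Lemma sf1 : (1 : A) x = 1. Proof. exact: cut_in. Qed.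
Lemma sf_cstE r : sf_cst r x = r. Proof. exact: cut_in. Qed.
Lemma to_smoothE u su : @to_smooth u su x = u x. Proof. exact: cut_in. Qed.

Lemma sf_sum (I : Type) (r : seq I) (P : pred I) (F : I -> A) :
  (\sum_(l <- r | P l) F l) x = \sum_(l <- r | P l) F l x.
Proof. exact: (big_morph (fun a : A => a x) sfD sf0). Qed.

(** The bridge from chart formulas to ring elements: [u] is free off [V], since a derivative at a
    point of an open set sees only that set. *)
Lemma sf_pdE i u a : (forall y, V y -> u y = a y) -> pd i u x = sf_pd i a x.
Proof. by move=> e; rewrite to_smoothE; exact: (pd_eq_on i Vo Vx e). Qed.

End Evaluation.

Lemma sf_pdD i : {morph sf_pd i : a b / a + b}.
Proof.
move=> a b; apply: smooth_fun_eq => x Vx; rewrite sfD // !to_smoothE //.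
rewrite (pd_eq_on (v := fun y => a y + b y) i Vo Vx) => [|y Vy]; last by rewrite sfD.
by rewrite pdD //; apply: smooth_derivable (smooth_valP _) Vx.
Qed.

Lemma sf_pdM i a b : sf_pd i (a * b) = sf_pd i a * b + a * sf_pd i b.
Proof.
apply: smooth_fun_eq => x Vx; rewrite sfD // !sfM // !to_smoothE //.
rewrite (pd_eq_on (v := fun y => a y * b y) i Vo Vx) => [|y Vy]; last by rewrite sfM.
by rewrite pdM //; apply: smooth_derivable (smooth_valP _) Vx.
Qed.

Lemma sf_pdC i j a : sf_pd i (sf_pd j a) = sf_pd j (sf_pd i a).
Proof.
apply: smooth_fun_eq => x Vx.
have e k l : sf_pd k (sf_pd l a) x = pd k (pd l a) x.
  by symmetry; apply: sf_pdE => // y Vy; symmetry; exact: cut_in.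
have c : pd i (pd j a) x = pd j (pd i a) x by exact: pdC Vo (smooth_valP a) Vx.
exact: etrans (e i j) (etrans c (esym (e j i))).
Qed.

Lemma sf_half : sf_cst 2^-1 + sf_cst 2^-1 = 1.
Proof.
apply: smooth_fun_eq => x Vx; rewrite [RHS]sf1 // sfD // !sf_cstE //; lra.
Qed.

End SmoothRing.

(** * Evaluation of the formal identities in a chart *)

Section LocalGeometry.
Context {R : realType} {n : nat} {V : set 'rV[R]_n} (Vo : open V).
Variables (g : 'rV[R]_n -> 'M[R]_n) (f : 'rV[R]_n -> R) (mu : R).
Local Notation A := (smooth_fun_on Vo).
Implicit Types (x : 'rV[R]_n) (i j k l : 'I_n).
Hypothesis smooth_g : forall i j, smooth_on V (fun x => g x i j).
Hypothesis gT : forall x, V x -> (g x)^T = g x.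
Hypothesis g_unit : forall x, V x -> g x \in unitmx.

Let smooth_G i j : smooth_on V (ginv g i j).
Proof. exact: smooth_invmx. Qed.

Local Notation gs := (fun i j => to_smooth Vo (smooth_g i j)).
Local Notation Gs := (fun i j => to_smooth Vo (smooth_G i j)).
Local Notation half := (sf_cst Vo 2^-1).
Local Notation d := (@sf_pd R n V Vo).

Let gsC i j : gs i j = gs j i.
Proof.
by apply: smooth_fun_eq => x Vx; rewrite !to_smoothE // -[in RHS]gT // mxE.
Qed.

Let GsC i j : Gs i j = Gs j i.
Proof.
apply: smooth_fun_eq => x Vx; rewrite !to_smoothE // /ginv.
by rewrite -[in RHS](gT Vx) -trmx_inv mxE.
Qed.

Let gsGs i k : \sum_j gs i j * Gs j k = (i == k)%:R.
Proof.
apply: smooth_fun_eq => x Vx; rewrite sf_sum //.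
have := congr1 (fun X : 'M[R]_n => X i k) (mulmxV (g_unit Vx)).
rewrite !mxE => e; transitivity ((i == k)%:R : R).
  by rewrite -e; apply: eq_bigr => j _; rewrite sfM // !to_smoothE.
by case: (i == k); rewrite ?sf0 ?sf1.
Qed.

Let ginv_sf i j x : V x -> ginv g i j x = Gs i j x.
Proof. by move=> Vx; rewrite to_smoothE. Qed.

Lemma christoffel_sf l i j x : V x ->
  christoffel g l i j x = dGam d half gs Gs l i j x.
Proof.
move=> Vx; rewrite sfM // sf_cstE // sf_sum //; congr (_ * _).
apply: eq_bigr => m _; rewrite sfM // to_smoothE //; congr (_ * _).
rewrite sfB // sfD //; congr (_ + _ - _); apply: sf_pdE => // y Vy;
  by rewrite to_smoothE.
Qed.

Lemma riem_sf i j k l x : V x -> riem g i j k l x = driem d half gs Gs i j k l x.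
Proof.
move=> Vx; rewrite sf_sum //; apply: eq_bigr => m _.
rewrite sfM // to_smoothE //; congr (_ * _).
rewrite sfD // sfB // sf_sum //; congr (_ - _ + _).
- by apply: sf_pdE => // y Vy; exact: christoffel_sf.
- by apply: sf_pdE => // y Vy; exact: christoffel_sf.
have q (a b c e : A) : a x * b x - c x * e x = (a * b - c * e) x.
  by rewrite sfB // !sfM.
by apply: eq_bigr => p _; rewrite !christoffel_sf //; exact: q.
Qed.

Lemma ricci_sf i k x : V x -> ricci g x i k = dric d half gs Gs i k x.
Proof.
move=> Vx; rewrite mxE sf_sum //; apply: eq_bigr => j _.
rewrite sf_sum //; apply: eq_bigr => l _.
by rewrite sfM // to_smoothE // riem_sf //.
Qed.

Lemma cov1_sf (w : 'rV[R]_n -> 'rV[R]_n) (ws : 'I_n -> A) i j x :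
  (forall x i, V x -> w x 0 i = ws i x) -> V x ->
  cov1 g w x i j = dcov1 d half gs Gs ws i j x.
Proof.
move=> e Vx; rewrite mxE sfB // sf_sum //; congr (_ - _).
  by apply: sf_pdE => // y Vy; exact: e.
by apply: eq_bigr => l _; rewrite sfM // christoffel_sf // e //.
Qed.

Lemma cov2_sf (h : 'rV[R]_n -> 'M[R]_n) (hs : 'I_n -> 'I_n -> A) k i j x :
  (forall x i j, V x -> h x i j = hs i j x) -> V x ->
  cov2 g h k i j x = dcov2 d half gs Gs hs k i j x.
Proof.
move=> e Vx; rewrite sfB // sf_sum //; congr (_ - _).
  by apply: sf_pdE => // y Vy; exact: e.
have q (a b c r : A) : a x * b x + c x * r x = (a * b + c * r) x.
  by rewrite sfD // !sfM.
by apply: eq_bigr => l _; rewrite !christoffel_sf // !e //; exact: q.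
Qed.

Lemma cov3_sf (T : 'I_n -> 'I_n -> 'I_n -> 'rV[R]_n -> R)
    (Ts : 'I_n -> 'I_n -> 'I_n -> A) m k i j x :
  (forall x k i j, V x -> T k i j x = Ts k i j x) -> V x ->
  cov3 g T m k i j x = dcov3 d half gs Gs Ts m k i j x.
Proof.
move=> e Vx; rewrite sfB // sf_sum //; congr (_ - _).
  by apply: sf_pdE => // y Vy; exact: e.
have q (a b c r s t : A) :
    a x * b x + c x * r x + s x * t x = (a * b + c * r + s * t) x.
  by rewrite sfD // sfD // !sfM.
by apply: eq_bigr => l _; rewrite !christoffel_sf // !e //; exact: q.
Qed.

(** The symbol agrees on [V] with a ring element, which is smooth by construction. *)
Lemma smooth_christoffel l i j : smooth_on V (christoffel g l i j).
Proof.
apply: smooth_ext (smooth_valP (dGam d half gs Gs l i j)) => // x Vx.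
by rewrite christoffel_sf.
Qed.

Lemma smooth_ricci i k : smooth_on V (fun x => ricci g x i k).
Proof.
apply: smooth_ext (smooth_valP (dric d half gs Gs i k)) => // x Vx.
by rewrite ricci_sf.
Qed.

Hypothesis smooth_f : smooth_on V f.
Hypothesis soliton : forall x, V x -> ricci g x + hess g f x = mu *: g x.

Let F i := sf_pd i (to_smooth Vo smooth_f).

Let F_E i x : V x -> pd i f x = F i x.
Proof. by move=> Vx; apply: sf_pdE => // y Vy; rewrite to_smoothE. Qed.

Let hess_sf i j x : V x -> hess g f x i j = dcov1 d half gs Gs F i j x.
Proof. by move=> Vx; apply: cov1_sf => // y k Vy; rewrite mxE F_E. Qed.

Let soliton_sf i k :
  dric d half gs Gs i k + dcov1 d half gs Gs F i k = sf_cst Vo mu * gs i k.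
Proof.
apply: smooth_fun_eq => x Vx; rewrite sfD // sfM // sf_cstE // to_smoothE //.
rewrite -ricci_sf // -hess_sf //.
by have := congr1 (fun X : 'M[R]_n => X i k) (soliton Vx); rewrite !mxE.
Qed.

Let d_mu i : d i (sf_cst Vo mu) = 0.
Proof.
apply: smooth_fun_eq => x Vx; rewrite sf0 // -(pd_cst i mu x).
by symmetry; apply: sf_pdE => // y Vy; rewrite sf_cstE.
Qed.

Let DF i j : d i (F j) = d j (F i).
Proof. exact: sf_pdC. Qed.

Lemma divf2_ricci x : V x -> divf2 g f (ricci g) x = 0.
Proof.
move=> Vx; apply/rowP => i; rewrite !mxE.
have := divf_ric (@sf_pdD _ _ _ Vo) (@sf_pdM _ _ _ Vo) (@sf_pdC _ _ _ Vo)
  (sf_half Vo) gsC GsC gsGs DF d_mu soliton_sf i.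
move=> /(congr1 (fun a : A => a x)); rewrite sf0 // sf_sum // => e.
rewrite -[RHS]e; apply: eq_bigr => j _; rewrite sf_sum //; apply: eq_bigr => k _.
rewrite sfM // to_smoothE // sfB // sfM // -F_E // -ricci_sf //.
by rewrite -(cov2_sf _ _ _ (fun x i j => @ricci_sf i j x)).
Qed.

Lemma Lf_ricci x : V x -> Lf g f (ricci g) x = mu *: ricci g x.
Proof.
move=> Vx; apply/matrixP => i j.
have := Lf_ric (@sf_pdD _ _ _ Vo) (@sf_pdM _ _ _ Vo) (@sf_pdC _ _ _ Vo)
  (sf_half Vo) gsC GsC gsGs DF d_mu soliton_sf i j.
move=> /(congr1 (fun a : A => a x)).
rewrite sfD // !sfM // !sf_cstE // -ricci_sf // => e.
rewrite [RHS]mxE -[RHS]e /Lf mxE [X in X + _]mxE /laplf2 /Rm_act.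
rewrite [in X in X + _]mxE [X in _ + X]mxE; congr (_ * _ + _).
  rewrite sf_sum //; apply: eq_bigr => k _; rewrite sf_sum //; apply: eq_bigr => l _.
  have e2 y k' i' j' : V y -> cov2 g (ricci g) k' i' j' y
      = dcov2 d half gs Gs (dric d half gs Gs) k' i' j' y.
    by move=> Vy; apply: cov2_sf => // z a b Vz; exact: ricci_sf.
  by rewrite sfM // to_smoothE // sfB // sfM // -F_E // -e2 // -(cov3_sf _ _ _ _ e2).
rewrite sf_sum //; apply: eq_bigr => b _; rewrite sf_sum //; apply: eq_bigr => l _.
rewrite sf_sum //; apply: eq_bigr => p _; rewrite sf_sum //; apply: eq_bigr => q _.
by rewrite riem_sf // ricci_sf // !ginv_sf // -!sfM.
Qed.

End LocalGeometry.

(** * Change of coordinates *)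

Lemma congruence_invmx (F : fieldType) (n : nat) (A B J : 'M[F]_n) :
  A \in unitmx -> A = J *m B *m J^T ->
  [/\ J \in unitmx, B \in unitmx & J^T *m invmx A *m J = invmx B].
Proof.
move=> uA e; have := uA; rewrite e !unitmx_mul unitmx_tr => /andP[/andP[uJ uB] _].
split=> //; have uJT : J^T \in unitmx by rewrite unitmx_tr.
apply: (can_inj (mulKmx uB)); rewrite mulmxV //.
apply: (can_inj (mulKmx uJ)); rewrite mulmx1 !mulmxA -e.
by rewrite mulmxV // mul1mx.
Qed.

Lemma is_derive_mul (R : realType) (W : normedModType R) (f h : W -> R) x v df dh :
  is_derive x v f df -> is_derive x v h dh ->
  is_derive x v (fun y => f y * h y) (df * h x + f x * dh).
Proof.
move=> Df Dh; have D := @is_deriveM _ _ f h x v df dh Df Dh.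
apply: (@is_derive_eq _ _ _ _ _ _ _ _ D).
by rewrite addrC; congr (_ + _); rewrite [_ *: _]mulrC.
Qed.

Lemma is_derive_bigsum (R : realType) (W : normedModType R) (n : nat)
  (F : 'I_n -> W -> R) x v d : (forall k, is_derive x v (F k) (d k)) ->
  is_derive x v (fun y => \sum_k F k y) (\sum_k d k).
Proof.
move=> D; have := @is_derive_sum _ _ _ n F x v d D.
by rewrite (_ : \sum_k F k = fun y => \sum_k F k y) //; apply/funext => y; rewrite fct_sumE.
Qed.

Lemma invmx_sym (F : fieldType) (n : nat) (A : 'M[F]_n) :
  (forall i j, A i j = A j i) -> forall i j, invmx A i j = invmx A j i.
Proof.
move=> AC i j; have AT : A^T = A by apply/matrixP => k l; rewrite mxE.
by rewrite -[in LHS]AT -trmx_inv mxE.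
Qed.

Section CoordinateChange.
Context {R : realType} {n : nat} {V W : set 'rV[R]_n}.
Local Notation E := 'rV[R]_n.
Variables (Vo : open V) (Wo : open W) (phi : E -> E) (ga gb : E -> 'M[R]_n)
  (u : E -> R).
Implicit Types (x : E) (i j k l m p q r s : 'I_n).
Hypothesis phiV : forall x, W x -> V (phi x).
Hypothesis smooth_phi : forall k, smooth_on W (fun x => phi x 0 k).
Hypothesis smooth_gb : forall i j, smooth_on V (fun x => gb x i j).
Hypothesis gbT : forall x, V x -> (gb x)^T = gb x.
Hypothesis ga_unit : forall x, W x -> ga x \in unitmx.
Hypothesis smooth_u : smooth_on V u.

Let J x : 'M[R]_n := \matrix_(i, k) pd i (fun y => phi y 0 k) x.

Hypothesis gaE : forall x, W x -> ga x = J x *m gb (phi x) *m (J x)^T.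

Let smooth_J i k : smooth_on W (fun x => J x i k).
Proof.
by apply: smooth_ext (smooth_pd i (smooth_phi k)) => // x _; rewrite mxE.
Qed.

Lemma is_derive_pullback v x i : smooth_on V v -> W x ->
  is_derive x (delta_mx 0 i) (v \o phi) (\sum_k J x i k * pd k v (phi x)).
Proof.
move=> sv Wx; under eq_bigr => k _ do rewrite mxE.
exact: pd_comp Vo (phiV Wx) sv Wx smooth_phi.
Qed.

Lemma pd_pullback v x i : smooth_on V v -> W x ->
  pd i (v \o phi) x = \sum_k J x i k * pd k v (phi x).
Proof. by move=> sv Wx; have [_ <-] := is_derive_pullback i sv Wx. Qed.

Section AtPoint.
Variables (x : E) (Wx : W x).

Let B i j k := pd i (fun y => J y j k) x.

Let BC i j k : B i j k = B j i k.
Proof.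
have e l m : B l m k = pd l (pd m (fun y => phi y 0 k)) x.
  by apply: (pd_eq_on l Wo Wx) => y _; rewrite mxE.
by rewrite !e; exact: pdC Wo (smooth_phi k) Wx.
Qed.

Let is_derive_J i j k : is_derive x (delta_mx 0 i) (fun y => J y j k) (B i j k).
Proof. by apply: derivableP; exact: smooth_derivable (smooth_J j k) Wx. Qed.

Let pd2_u i j : pd i (pd j (u \o phi)) x
  = \sum_k (B i j k * pd k u (phi x)
            + J x j k * \sum_m J x i m * pd m (pd k u) (phi x)).
Proof.
have e y : W y -> pd j (u \o phi) y = \sum_k J y j k * (pd k u \o phi) y.
  by move=> Wy; rewrite pd_pullback.
rewrite (pd_eq_on i Wo Wx e).
have [_ //] : is_derive x (delta_mx 0 i)
    (fun y => \sum_k J y j k * (pd k u \o phi) y)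
    (\sum_k (B i j k * pd k u (phi x)
            + J x j k * \sum_m J x i m * pd m (pd k u) (phi x))).
apply: is_derive_bigsum => k; apply: is_derive_mul; first exact: is_derive_J.
exact: is_derive_pullback (smooth_pd k smooth_u) Wx.
Qed.

(** Differentiating $Jg_bJ^T$ yields terms with second derivatives of the transition map, collected
    in [T], and terms with first derivatives of [gb], collected in [S]. *)
Let T i j m := \sum_p \sum_q B i j p * gb (phi x) p q * J x m q.

Let S i j m := \sum_r \sum_p \sum_q
  J x i r * J x j p * J x m q * pd r (fun y => gb y p q) (phi x).

Let TC i j m : T i j m = T j i m.
Proof. by apply: eq_bigr => p _; apply: eq_bigr => q _; rewrite BC. Qed.

Let gbC p q : gb (phi x) p q = gb (phi x) q p.
Proof. by rewrite -[in LHS](gbT (phiV Wx)) mxE. Qed.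

Let pd_ga i j m : pd i (fun y => ga y j m) x = T i j m + T i m j + S i j m.
Proof.
have e y : W y -> ga y j m
    = \sum_p \sum_q J y j p * ((fun z => gb z p q) \o phi) y * J y m q.
  move=> Wy; rewrite gaE // mxE exchange_big; apply: eq_bigr => q _ /=.
  by rewrite [(J y)^T _ _]mxE mxE mulr_suml.
rewrite (pd_eq_on i Wo Wx e).
transitivity (\sum_p \sum_q
    (B i j p * gb (phi x) p q * J x m q
     + J x j p * gb (phi x) p q * B i m q
     + \sum_r J x i r * J x j p * J x m q * pd r (fun y => gb y p q) (phi x))).
  have [_ //] : is_derive x (delta_mx 0 i)
      (fun y => \sum_p \sum_q J y j p * ((fun z => gb z p q) \o phi) y * J y m q)
      (\sum_p \sum_q
    (B i j p * gb (phi x) p q * J x m q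
     + J x j p * gb (phi x) p q * B i m q
     + \sum_r J x i r * J x j p * J x m q * pd r (fun y => gb y p q) (phi x))).
  apply: is_derive_bigsum => p; apply: is_derive_bigsum => q.
  have -> : \sum_r J x i r * J x j p * J x m q * pd r (fun y => gb y p q) (phi x)
      = J x j p * (\sum_r J x i r * pd r (fun y => gb y p q) (phi x)) * J x m q.
    by rewrite mulr_sumr mulr_suml; apply: eq_bigr => r _; ring.
  have D := is_derive_mul (is_derive_mul (is_derive_J i j p)
    (is_derive_pullback i (smooth_gb p q) Wx)) (is_derive_J i m q).
  apply: (@is_derive_eq _ _ _ _ _ _ _ _ D) => /=; ring.
under eq_bigr => p _ do rewrite !big_split /=.
rewrite !big_split /=; congr (_ + _ + _).
  rewrite exchange_big; apply: eq_bigr => q _; apply: eq_bigr => p _ /=.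
  by rewrite (gbC p q); ring.
under eq_bigr => p _ do rewrite exchange_big.
by rewrite exchange_big.
Qed.

(** Twice the Christoffel symbol of the first kind. *)
Let lower (h : E -> 'M[R]_n) y i j m := pd i (fun z => h z j m) y
  + pd j (fun z => h z i m) y - pd m (fun z => h z i j) y.

(** Of the six [T] terms, four cancel by symmetry in the first two indices and the other two are
    equal. *)
Let lower_ga i j m : lower ga x i j m
  = \sum_q J x m q * (2 * (\sum_p B i j p * gb (phi x) p q)
                      + \sum_r \sum_s J x i r * J x j s * lower gb (phi x) r s q).
Proof.
rewrite /lower !pd_ga (TC j i) (TC m i) (TC m j).
transitivity (2 * T i j m + (S i j m + S j i m - S m i j)); first by ring.
under [RHS]eq_bigr => q _ do rewrite mulrDr.
rewrite [RHS]big_split /=; congr (_ + _).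
  rewrite /T exchange_big mulr_sumr; apply: eq_bigr => q _ /=.
  by rewrite [RHS]mulrCA [in RHS]mulr_sumr; congr (_ * _); apply: eq_bigr => p _; ring.
have eS1 : S i j m = \sum_q \sum_r \sum_s
    J x m q * (J x i r * J x j s * pd r (fun y => gb y s q) (phi x)).
  rewrite /S; under eq_bigr => r _ do rewrite exchange_big.
  rewrite exchange_big; apply: eq_bigr => q _ /=.
  by apply: eq_bigr => r _; apply: eq_bigr => p _; ring.
have eS2 : S j i m = \sum_q \sum_r \sum_s
    J x m q * (J x i r * J x j s * pd s (fun y => gb y r q) (phi x)).
  rewrite /S exchange_big; under eq_bigr => r _ do rewrite exchange_big.
  rewrite exchange_big; apply: eq_bigr => q _ /=.
  by apply: eq_bigr => r _; apply: eq_bigr => p _; ring.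
have eS3 : S m i j = \sum_q \sum_r \sum_s
    J x m q * (J x i r * J x j s * pd q (fun y => gb y r s) (phi x)).
  by apply: eq_bigr => q _; apply: eq_bigr => r _; apply: eq_bigr => p _; ring.
rewrite eS1 eS2 eS3 -!big_split -sumrB; apply: eq_bigr => q _ /=.
rewrite mulr_sumr -!big_split -sumrB; apply: eq_bigr => r _ /=.
rewrite mulr_sumr -!big_split -sumrB; apply: eq_bigr => s _ /=.
by rewrite /lower; ring.
Qed.

Let christoffel_lower h y l i j :
  christoffel h l i j y = 2^-1 * \sum_m ginv h l m y * lower h y i j m.
Proof. by []. Qed.

(** The transformation law of the Christoffel symbols. Contracting the upper index with $J$ lets
    [congruence_invmx] turn the inverse of [ga] into that of [gb]. *)
Let sum_christoffel i j (w : 'I_n -> R) :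
  \sum_l christoffel ga l i j x * (\sum_k J x l k * w k)
  = \sum_k (B i j k + \sum_r \sum_s J x i r * J x j s
                        * christoffel gb k r s (phi x)) * w k.
Proof.
have [uJ uB JGJ] := congruence_invmx (ga_unit Wx) (gaE Wx).
pose Z q := 2 * (\sum_p B i j p * gb (phi x) p q)
            + \sum_r \sum_s J x i r * J x j s * lower gb (phi x) r s q.
have gaT : (ga x)^T = ga x.
  by rewrite gaE // !trmx_mul trmxK gbT ?mulmxA //; exact: phiV.
have GG k q : \sum_l \sum_m J x l k * (ginv ga l m x * J x m q) = ginv gb k q (phi x).
  rewrite /ginv -JGJ -mulmxA mxE; apply: eq_bigr => l _.
  by rewrite !mxE mulr_sumr.
transitivity (\sum_k \sum_q ginv gb k q (phi x) * (2^-1 * Z q) * w k); last first.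
  apply: eq_bigr => k _; rewrite -mulr_suml; congr (_ * _).
  have eZ q : 2^-1 * Z q = \sum_p B i j p * gb (phi x) p q
      + \sum_r \sum_s J x i r * J x j s * (2^-1 * lower gb (phi x) r s q).
    rewrite mulrDr mulrA mulVf ?pnatr_eq0 // mul1r; congr (_ + _).
    rewrite mulr_sumr; apply: eq_bigr => r _; rewrite mulr_sumr.
    by apply: eq_bigr => s _; ring.
  under eq_bigr => q _ do rewrite eZ mulrDr.
  rewrite big_split /=; congr (_ + _).
    under eq_bigr => q _ do rewrite mulr_sumr.
    rewrite exchange_big /=.
    have := congr1 (fun X : 'M[R]_n => (\row_p B i j p *m X) 0 k) (mulmxV uB).
    rewrite mulmx1 !mxE => <-; apply: eq_bigr => p _; rewrite !mxE mulr_sumr.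
    by apply: eq_bigr => q _; rewrite /ginv (invmx_sym gbC k q); ring.
  under eq_bigr => q _ do rewrite mulr_sumr.
  rewrite exchange_big /=; apply: eq_bigr => r _.
  under eq_bigr => q _ do rewrite mulr_sumr.
  rewrite exchange_big /=; apply: eq_bigr => s _.
  rewrite christoffel_lower !mulr_sumr; apply: eq_bigr => q _; ring.
under eq_bigr => l _ do rewrite christoffel_lower mulr_sumr.
rewrite exchange_big; apply: eq_bigr => k _ /=.
under [RHS]eq_bigr => q _ do rewrite -GG !mulr_suml.
rewrite exchange_big; apply: eq_bigr => l _ /=.
under [RHS]eq_bigr => q _ do rewrite !mulr_suml.
rewrite [RHS]exchange_big /= mulr_sumr mulr_suml; apply: eq_bigr => m _.
rewrite lower_ga -/(Z _) mulr_sumr mulr_sumr mulr_suml; apply: eq_bigr => q _.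
by rewrite /Z; ring.
Qed.

(** The second derivatives [B] of the transition map, produced by the chain rule, cancel against the
    inhomogeneous term of [sum_christoffel]. *)
Lemma hess_pullback : hess ga (u \o phi) x = J x *m hess gb u (phi x) *m (J x)^T.
Proof.
apply/matrixP => i j; rewrite mxE.
under eq_bigr => l _ do rewrite mxE pd_pullback //.
rewrite sum_christoffel.
have -> : pd i (fun y => grad (u \o phi) y 0 j) x = pd i (pd j (u \o phi)) x.
  by apply: (pd_eq_on i Wo Wx) => y _; rewrite mxE.
transitivity (\sum_k \sum_m J x j k * (J x i m * pd m (pd k u) (phi x))
    - \sum_k \sum_m \sum_l
        J x i m * J x j k * christoffel gb l m k (phi x) * pd l u (phi x)).
  have -> : \sum_k \sum_m \sum_l
        J x i m * J x j k * christoffel gb l m k (phi x) * pd l u (phi x)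
      = \sum_l (\sum_m \sum_k J x i m * J x j k * christoffel gb l m k (phi x))
               * pd l u (phi x).
    under eq_bigr => k _ do rewrite exchange_big.
    rewrite exchange_big; apply: eq_bigr => l _ /=.
    rewrite exchange_big mulr_suml; apply: eq_bigr => m _ /=.
    by rewrite mulr_suml.
  rewrite pd2_u -!sumrB; apply: eq_bigr => k _.
  by rewrite mulr_sumr; ring.
rewrite [RHS]mxE -sumrB; apply: eq_bigr => k _.
rewrite [(J x)^T _ _]mxE [(J x *m _) _ _]mxE mulr_suml -sumrB; apply: eq_bigr => m _.
rewrite [hess _ _ _ _ _]mxE.
rewrite (_ : pd m (fun y => grad u y 0 k) (phi x) = pd m (pd k u) (phi x)); last first.
  by congr ('D_ _ _ _); apply/funext => y; rewrite mxE.
have -> : \sum_l J x i m * J x j k * christoffel gb l m k (phi x) * pd l u (phi x)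
    = J x i m * J x j k * \sum_l christoffel gb l m k (phi x) * grad u (phi x) 0 l.
  by rewrite mulr_sumr; apply: eq_bigr => l _; rewrite [grad _ _ _ _]mxE mulrA.
ring.
Qed.

End AtPoint.
End CoordinateChange.

(** * Positive definite matrices *)

Section PositiveDefinite.
Context {R : realType}.

Definition posdef n (A : 'M[R]_n) :=
  forall y : 'rV[R]_n, y != 0 -> 0 < (y *m A *m y^T) 0 0.

Lemma posdef_unit n (A : 'M[R]_n) : posdef A -> A \in unitmx.
Proof.
move=> pA; rewrite unitmxE unitfE; apply/negP => /det0P[v v0 vA].
by have := pA v v0; rewrite vA mul0mx mxE ltxx.
Qed.

(* Cholesky, by induction through the Schur complement of the first entry *)
Lemma posdef_factor n (A : 'M[R]_n) : A^T = A -> posdef A ->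
  exists P : 'M[R]_n, A = P *m P^T.
Proof.
elim: n A => [|n IH] A AT pA.
  by exists 0; apply/matrixP => -[].
change 'M[R]_(1 + n) in A.
pose a := A 0 0; pose v : 'rV[R]_n := ursubmx A; pose B : 'M[R]_n := drsubmx A.
have a_gt0 : 0 < a.
  have := pA (delta_mx 0 0); rewrite -rowE trmx_delta -colE !mxE; apply.
  by apply/eqP => /matrixP/(_ 0 0)/eqP; rewrite !mxE oner_eq0.
have ulA : ulsubmx A = a%:M.
  apply/matrixP => i j; rewrite !ord1 !mxE eqxx mulr1n /a.
  by congr (A _ _); apply: val_inj.
have dlA : dlsubmx A = v^T by rewrite /v trmx_ursub AT.
have AE : A = block_mx a%:M v v^T B by rewrite -ulA -dlA submxK.
have BT : B^T = B by rewrite /B trmx_drsub AT.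
pose B' := B - a^-1 *: (v^T *m v).
have B'T : B'^T = B' by rewrite /B' linearB linearZ /= trmx_mul trmxK BT.
have pB' : posdef B'.
  (* This [c] completes the square: the form of [A] at [row_mx c y] is that of the Schur complement
     at [y]. *)
  move=> y y0; pose c : 'M[R]_1 := - a^-1 *: (v *m y^T).
  have z0 : row_mx c y != 0.
    apply: contra y0 => /eqP e; rewrite -(row_mxKr c y) e.
    by apply/eqP/matrixP => i j; rewrite !mxE.
  have := pA _ z0.
  suff -> : row_mx c y *m A *m (row_mx c y)^T = y *m B' *m y^T by [].
  rewrite AE tr_row_mx mul_row_block mul_row_col.
  have vyT : y *m v^T = v *m y^T.
    have t1 (X : 'M[R]_1) : X^T = X by apply/matrixP => i j; rewrite !ord1 mxE.
    by rewrite -[LHS]t1 trmx_mul trmxK.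
  rewrite mul_mx_scalar mulmxDl -scalemxAl.
  have -> : a *: (c *m c^T) + y *m v^T *m c^T = 0.
    rewrite {1}/c scalemxAl scalerA mulrN divff ?gt_eqF // scaleN1r mulNmx vyT.
    by rewrite addNr.
  rewrite add0r mulmxDl /B' mulmxBr mulmxBl addrC; congr (_ + _).
  rewrite /c scaleNr mulNmx mulNmx; congr (- _).
  rewrite -scalemxAl -scalemxAl -scalemxAr -scalemxAl; congr (_ *: _).
  by rewrite -vyT -!mulmxA.
have [P' B'E] := IH _ B'T pB'.
pose s := Num.sqrt a; have s0 : s != 0 by rewrite gt_eqF // sqrtr_gt0.
have s2 : s * s = a by rewrite -expr2 sqr_sqrtr // ltW.
suff e : A = block_mx s%:M 0 (s^-1 *: v^T) P' *m (block_mx s%:M 0 (s^-1 *: v^T) P')^T.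
  by exists (block_mx s%:M 0 (s^-1 *: v^T) P').
rewrite [LHS]AE tr_block_mx mulmx_block !linearZ /= trmxK trmx0 tr_scalar_mx.
rewrite !mul0mx !mulmx0 !addr0 -scalar_mxM s2; congr block_mx.
- by rewrite mul_scalar_mx scalerA ?divff ?mulVf // scale1r.
- by rewrite mul_mx_scalar scalerA ?divff ?mulVf // scale1r.
rewrite -?scalemxAl -?scalemxAr scalerA -B'E /B' -invfM s2.
by rewrite addrC subrK.
Qed.

Lemma mxtrace_mulT n m (X : 'M[R]_(n, m)) :
  \tr (X *m X^T) = \sum_i \sum_j X i j ^+ 2.
Proof.
by apply: eq_bigr => i _; rewrite mxE; apply: eq_bigr => j _; rewrite mxE expr2.
Qed.

Lemma inner2E n (g h k : 'rV[R]_n -> 'M[R]_n) x :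
  inner2 g h k x
  = \tr ((invmx (g x))^T *m h x *m invmx (g x) *m (k x)^T).
Proof.
rewrite /inner2 /mxtrace.
under eq_bigr => i _ do rewrite exchange_big /=.
rewrite exchange_big /=; apply: eq_bigr => c _.
under eq_bigr => i _ do rewrite exchange_big /=.
rewrite exchange_big mxE; apply: eq_bigr => l _ /=.
rewrite [(k x)^T _ _]mxE mxE exchange_big mulr_suml; apply: eq_bigr => j _ /=.
rewrite mxE !mulr_suml; apply: eq_bigr => i _.
by rewrite [_^T _ _]mxE /ginv; ring.
Qed.

(** For $g=PP^T$ and $X=P^{-1}hP^{-T}$ the inner product is $\operatorname{tr}(XX^T)$, a sum of
    squares. *)
Lemma inner2_posdef n (g h : 'rV[R]_n -> 'M[R]_n) x :
  (g x)^T = g x -> posdef (g x) ->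
  0 <= inner2 g h h x /\ (inner2 g h h x = 0 -> h x = 0).
Proof.
move=> gT pg; have ug := posdef_unit pg; have [P gE] := posdef_factor gT pg.
have uP : P \in unitmx by move: ug; rewrite gE unitmx_mul => /andP[].
have uPT : P^T \in unitmx by rewrite unitmx_tr.
have gV : invmx (g x) = (invmx P)^T *m invmx P.
  apply: (can_inj (mulKmx ug)); rewrite mulmxV // gE trmx_inv.
  by rewrite mulmxA -[P *m _ *m _]mulmxA mulmxV // mulmx1 mulmxV.
pose X := invmx P *m h x *m (invmx P)^T.
have eX : inner2 g h h x = \tr (X *m X^T).
  rewrite inner2E gV trmx_mul trmxK /X !trmx_mul trmxK.
  by rewrite -!mulmxA mxtrace_mulC -!mulmxA.
have sq0 i : 0 <= \sum_j X i j ^+ 2 by apply: sumr_ge0 => j _; exact: sqr_ge0.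
rewrite eX mxtrace_mulT; split; first by apply: sumr_ge0 => i _.
move=> X0; have {}X0 : X = 0.
  apply/matrixP => i j; rewrite [RHS]mxE; apply/eqP; rewrite -sqrf_eq0; apply/eqP.
  have Xi : \sum_j X i j ^+ 2 = 0 by apply: (psumr_eq0P _ X0).
  by apply: (psumr_eq0P _ Xi) => // l _; exact: sqr_ge0.
have : P *m X *m P^T = 0 by rewrite X0 mulmx0 mul0mx.
by rewrite /X !mulmxA mulmxV // mul1mx -mulmxA -trmx_mul mulmxV // trmx1 mulmx1.
Qed.

Lemma posdef_det n (A : 'M[R]_n) : A^T = A -> posdef A -> 0 < \det A.
Proof.
move=> AT pA; have uA := posdef_unit pA; have [P e] := posdef_factor AT pA.
rewrite lt_neqAle eq_sym -unitfE -unitmxE uA e det_mulmx det_tr -expr2.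
exact: sqr_ge0.
Qed.

End PositiveDefinite.

(** * Gradient shrinking solitons *)

Section Charts.
Context {R : realType} {n : nat} (M : smoothManifold R n).
Implicit Types (a b : chart M) (x : 'rV[R]_n) (p : M).

Lemma chart_imgP a x : chart_img a x ->
  dom a (param a x) /\ coord a (param a x) = x.
Proof. by move=> [p ap <-]; rewrite coordK. Qed.

Lemma chart_img_coord a p : dom a p -> chart_img a (coord a p).
Proof. by exists p. Qed.

Lemma open_chart_img a : open (chart_img a).
Proof. exact: open_coord. Qed.

Definition overlap a b : set 'rV[R]_n := coord a @` (dom a `&` dom b).

Lemma overlapP a b x :
  overlap a b x <-> chart_img a x /\ dom b (param a x).
Proof.
split=> [[p [ap bp] <-]|[[p ap <-]]]; last by rewrite coordK // => bp; exists p.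
by rewrite coordK //; split=> //; exists p.
Qed.

Lemma open_overlap a b : open (overlap a b).
Proof.
rewrite openE => x /overlapP[ax bx]; rewrite /interior.
have nb : nbhs (param a x) (dom b) by apply: open_nbhs_nbhs; split=> //; exact: open_dom.
have na : nbhs x (chart_img a) by apply: open_nbhs_nbhs; split=> //; exact: open_coord.
have := param_continuous ax nb; rewrite nbhs_simpl /= => nb'.
apply: filterS (filterI na nb') => y [ay yb].
by apply/overlapP.
Qed.

Lemma overlap_transition a b x : overlap a b x ->
  chart_img b (coord b (param a x)) /\
  param b (coord b (param a x)) = param a x.
Proof.
by move=> /overlapP[ax bx]; rewrite coordK //; split=> //; exact: chart_img_coord.
Qed.

End Charts.

Section Soliton.
Context {R : realType} {n : nat} (M : smoothManifold R n).
Implicit Types (a b c : chart M) (x : 'rV[R]_n) (p : M) (h k : tensor2 M).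

Lemma hess_eq_on (V : set 'rV[R]_n) (g : 'rV[R]_n -> 'M[R]_n) u v x :
  open V -> V x -> (forall y, V y -> u y = v y) -> hess g u x = hess g v x.
Proof.
move=> Vo Vx e; have e1 i y : V y -> pd i u y = pd i v y.
  by move=> Vy; exact: pd_eq_on e.
apply/matrixP => i j; rewrite /hess /cov1 [LHS]mxE [RHS]mxE.
apply: (f_equal2 (fun r s : R => r - s)).
  by apply: pd_eq_on Vo Vx _ => y Vy; rewrite !mxE e1.
by apply: eq_bigr => l _; rewrite !mxE e1.
Qed.

Lemma christoffelC (V : set 'rV[R]_n) (g : 'rV[R]_n -> 'M[R]_n) l i j x :
  open V -> V x -> (forall y, V y -> (g y)^T = g y) ->
  christoffel g l i j x = christoffel g l j i x.
Proof.
move=> Vo Vx gT; congr (_ * _); apply: eq_bigr => m _; congr (_ * (_ - _)).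
  by rewrite addrC.
by apply: pd_eq_on Vo Vx _ => y Vy; rewrite -[in LHS]gT // mxE.
Qed.

Lemma hess_sym (V : set 'rV[R]_n) (g : 'rV[R]_n -> 'M[R]_n) u x :
  open V -> V x -> (forall y, V y -> (g y)^T = g y) -> smooth_on V u ->
  (hess g u x)^T = hess g u x.
Proof.
move=> Vo Vx gT su; apply/matrixP => i j; rewrite /hess /cov1 [LHS]mxE [LHS]mxE [RHS]mxE.
apply: (f_equal2 (fun r s : R => r - s)).
  transitivity (pd j (pd i u) x).
    by apply: pd_eq_on Vo Vx _ => y _; rewrite mxE.
  rewrite (pdC j i Vo su Vx).
  by apply: pd_eq_on Vo Vx _ => y _; rewrite mxE.
by apply: eq_bigr => l _; rewrite (christoffelC l j i Vo Vx gT).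
Qed.

Variables (g : tensor2 M) (f : M -> R) (tau : R).
Hypothesis soliton : gradient_shrinking_soliton g f tau.

Lemma metric_smooth a i j : smooth_on (chart_img a) (fun x => g a x i j).
Proof. by have [[[sg _ _] _] _ _] := soliton; exact: sg. Qed.

Lemma metric_sym a x : chart_img a x -> (g a x)^T = g a x.
Proof. by have [[[_ gs _] _] _ _] := soliton; exact: gs. Qed.

Lemma metric_posdef a x : chart_img a x -> posdef (g a x).
Proof. by have [[_ pg] _ _] := soliton => ax y; exact: pg. Qed.

Lemma metric_unit a x : chart_img a x -> g a x \in unitmx.
Proof. by move=> ax; apply: posdef_unit; exact: metric_posdef. Qed.

Lemma potential_smooth a : smooth_on (chart_img a) (f \o param a).
Proof. by have [_ sf _] := soliton; exact: sf. Qed.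

Lemma soliton_eq a x : chart_img a x ->
  ricci (g a) x + hess (g a) (f \o param a) x = (2 * tau)^-1 *: g a x.
Proof. by have [_ _] := soliton; exact. Qed.

Lemma divf2_Rc a x : chart_img a x ->
  divf2 (g a) (f \o param a) (Rc g a) x = 0.
Proof.
move=> ax; exact: (divf2_ricci (@open_chart_img _ _ M a) (metric_smooth a)
  (@metric_sym a) (@metric_unit a) (potential_smooth a) (@soliton_eq a) ax).
Qed.

Lemma Lf_Rc a x : chart_img a x ->
  calLf g f (Rc g) a x = (2 * tau)^-1 *: Rc g a x.
Proof.
move=> ax; exact: (Lf_ricci (@open_chart_img _ _ M a) (metric_smooth a)
  (@metric_sym a) (@metric_unit a) (potential_smooth a) (@soliton_eq a) ax).
Qed.

Let ricciE a x : chart_img a x ->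
  ricci (g a) x = (2 * tau)^-1 *: g a x - hess (g a) (f \o param a) x.
Proof. by move=> ax; rewrite -soliton_eq // addrK. Qed.

Lemma hess_transition a b x : overlap a b x ->
  hess (g a) (f \o param a) x = transition_jac a b x
    *m hess (g b) (f \o param b) (coord b (param a x)) *m (transition_jac a b x)^T.
Proof.
move=> Wx; pose phi y := coord b (param a y).
have phiV y : overlap a b y -> chart_img b (phi y) by move=> /overlap_transition[].
have sphi i : smooth_on (overlap a b) (fun y => phi y 0 i) by exact: transition_smooth.
have ug y : overlap a b y -> g a y \in unitmx by move=> /overlapP[ay _]; exact: metric_unit.
have gaE y : overlap a b y -> g a y = transition_jac a b y *m g b (phi y)
    *m (transition_jac a b y)^T.
  by move=> Wy; have [[[_ _ gt] _] _ _] := soliton; exact: gt.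
have H := hess_pullback (@open_chart_img _ _ M b) (@open_overlap _ _ M a b) phiV
  sphi (metric_smooth b) (@metric_sym b) ug (potential_smooth b) gaE Wx.
(* The two expressions of the potential agree on the overlap only, so locality of the Hessian is
   used. *)
rewrite -[RHS]H; apply: hess_eq_on (@open_overlap _ _ M a b) Wx _ => y Wy /=.
by have [_ ->] := overlap_transition Wy.
Qed.

Lemma smooth_sym2_Rc : smooth_sym2 (Rc g).
Proof.
split=> [a i j|a x ax|a b x Wx].
- exact: (smooth_ricci (@open_chart_img _ _ M a) (metric_smooth a) (@metric_unit a) i j).
- rewrite /Rc ricciE // linearB linearZ /= metric_sym //.
  rewrite (hess_sym (@open_chart_img _ _ M a)) //.
    exact: metric_sym.
  exact: potential_smooth.
have /overlapP[ax _] := Wx; have [bx _] := overlap_transition Wx.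
rewrite /Rc ricciE // ricciE // mulmxBr mulmxBl -hess_transition //.
rewrite -scalemxAr -scalemxAl; congr (_ *: _ - _).
by have [[[_ _ gt] _] _ _] := soliton; exact: gt.
Qed.

Lemma inner2_transition h k a b x : smooth_sym2 h -> smooth_sym2 k ->
  overlap a b x ->
  inner2 (g a) (h a) (k a) x = inner2 (g b) (h b) (k b) (coord b (param a x)).
Proof.
move=> [_ _ ht] [_ _ kt] Wx; have /overlapP[ax _] := Wx.
have [[[_ _ gt] _] _ _] := soliton.
have [uJ uB JGJ] := congruence_invmx (metric_unit ax) (gt a b x Wx).
rewrite !inner2E -JGJ (ht a b x Wx) (kt a b x Wx).
set J := transition_jac a b x; set G := invmx (g a x).
set hb := h b _; set kb := k b _.
by rewrite !trmx_mul !trmxK !mulmxA [LHS]mxtrace_mulC !mulmxA.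
Qed.

(** [inner] is computed in the chart chosen at each point, which may jump; continuity and
    integration require one fixed chart near a point. *)
Lemma inner_chart h k a p : smooth_sym2 h -> smooth_sym2 k -> dom a p ->
  inner g h k p = inner2 (g a) (h a) (k a) (coord a p).
Proof.
move=> sh sk ap; have cp := mem_chart_at p; rewrite /inner /at_point.
have Wx : overlap (chart_at p) a (coord (chart_at p) p) by exists p.
by rewrite (inner2_transition sh sk Wx) coordK.
Qed.

Lemma smooth_inner2 h k a : smooth_sym2 h -> smooth_sym2 k ->
  smooth_on (chart_img a) (inner2 (g a) (h a) (k a)).
Proof.
move=> [sh _ _] [sk _ _]; have ao := @open_chart_img _ _ M a.
have sG := smooth_invmx ao (@metric_unit a) (metric_smooth a).
do 4 ! (apply: smooth_sum => // ? _).
by do 3 ! (apply: smoothM => //); exact: sG.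
Qed.

Lemma continuous_chartwise (u : M -> R) :
  (forall a, exists2 v, smooth_on (chart_img a) v &
    forall p, dom a p -> u p = v (coord a p)) -> continuous u.
Proof.
move=> uE p; have ap := mem_chart_at p; set a := chart_at p in ap.
have [v sv e] := uE a.
have cv : {for coord a p, continuous v} by exact: smooth_continuous sv (chart_img_coord ap).
have cc : {for p, continuous (v \o coord a)}.
  by apply: continuous_comp cv; exact: coord_continuous.
have na : nbhs p (dom a) by apply: open_nbhs_nbhs; split=> //; exact: open_dom.
rewrite /continuous_at (e p ap); apply: near_eq_cvg_to cc.
by apply: filterS na => q aq /=; rewrite e.
Qed.

Lemma continuous_inner h k : smooth_sym2 h -> smooth_sym2 k ->
  continuous (inner g h k).
Proof.
move=> sh sk; apply: continuous_chartwise => a.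
by exists (inner2 (g a) (h a) (k a)); [exact: smooth_inner2 | move=> p; exact: inner_chart].
Qed.

Lemma continuous_potential : continuous f.
Proof.
apply: continuous_chartwise => a; exists (f \o param a); first exact: potential_smooth.
by move=> p ap /=; rewrite coordK.
Qed.

Lemma inner_ge0 h p : 0 <= inner g h h p.
Proof.
have ap := chart_img_coord (mem_chart_at p).
exact: (inner2_posdef (h (chart_at p)) (metric_sym ap) (metric_posdef ap)).1.
Qed.

Lemma inner_eq0 h : smooth_sym2 h -> (forall p, inner g h h p = 0) ->
  eq_tensor2 h (fun _ _ => 0).
Proof.
move=> sh h0 a x ax; have [ap e] := chart_imgP ax.
apply: (inner2_posdef (h a) (metric_sym ax) (metric_posdef ax)).2.
by rewrite -e -(inner_chart sh sh ap).
Qed.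

Definition sqrt_det a x := Num.sqrt (\det (g a x)).

Lemma sqrt_det_gt0 a x : chart_img a x -> 0 < sqrt_det a x.
Proof.
by move=> ax; rewrite sqrtr_gt0; exact: posdef_det (metric_sym ax) (metric_posdef ax).
Qed.

Lemma continuous_sqrt_det a x : chart_img a x -> {for x, continuous (sqrt_det a)}.
Proof.
move=> ax; have cd : {for x, continuous (fun y => \det (g a y))}.
  exact: smooth_continuous (smooth_det (@open_chart_img _ _ M a) (metric_smooth a)) ax.
by apply: continuous_comp cd _; exact: sqrt_continuous.
Qed.

End Soliton.

(** * Volume and integration *)

Section IteratedIntegral.
Context {R : realType}.
Local Open Scope ereal_scope.

(* The integral of a non-negative function is a supremum over the simple
   functions below it, measurable or not. *)
Lemma ge0_integral_mono d (T : measurableType d) (mu : {measure set T -> \bar R})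
  (F G : T -> \bar R) : (forall x, 0 <= F x) -> (forall x, F x <= G x) ->
  \int[mu]_x F x <= \int[mu]_x G x.
Proof.
move=> F0 FG; have G0 x : 0 <= G x by exact: le_trans (F0 x) (FG x).
rewrite !ge0_integralTE //; apply: ereal_sup_le => _ [h /= hF <-].
by exists h => // x; exact: le_trans (hF x) (FG x).
Qed.

Lemma iint_ge0 n (F : 'rV[R]_n -> \bar R) :
  (forall x, 0 <= F x) -> 0 <= lebesgue_iint F.
Proof.
elim: n F => [|n IH] F F0 /=; first exact: F0.
by apply: integral_ge0 => t _; apply: IH => y; exact: F0.
Qed.

Lemma iint_mono n (F G : 'rV[R]_n -> \bar R) :
  (forall x, 0 <= F x) -> (forall x, F x <= G x) ->
  lebesgue_iint F <= lebesgue_iint G.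
Proof.
elim: n F G => [|n IH] F G F0 FG /=; first exact: FG.
apply: ge0_integral_mono => t; first by apply: iint_ge0 => y; exact: F0.
by apply: IH => y; [exact: F0 | exact: FG].
Qed.

Lemma iint0 n : lebesgue_iint (fun _ : 'rV[R]_n => 0) = 0.
Proof.
by elim: n => [|n IH] //=; under eq_integral => t _ do rewrite IH; rewrite integral0.
Qed.

(** The cube is a product: for the first coordinate the inner integral is constant on an interval
    and zero off it, which yields one factor [r + r] per dimension. *)
Lemma iint_box n (c : 'rV[R]_n) (r k : R) : (0 < r)%R ->
  lebesgue_iint (fun x => if [forall i, `|(x - c)%R 0%R i| < r]%R then k%:E else 0)
  = (k * (r + r) ^+ n)%:E.
Proof.
move=> r0; elim: n c => [|n IH] c /=.
  by rewrite expr0 mulr1 (_ : [forall i, _]) //; apply/forallP => -[].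
pose c' : 'rV[R]_n := rsubmx (c : 'rV[R]_(1 + n)); pose c0 := c 0%R 0%R.
have e (t : R) : lebesgue_iint (fun y : 'rV[R]_n =>
    if [forall i, `|((row_mx t%:M y : 'rV[R]_(1 + n)) - c)%R 0%R i| < r]%R
    then k%:E else 0)
  = ((fun=> (k * (r + r) ^+ n)%:E) \_ `]c0 - r, c0 + r[%classic)%R t.
  have ec (y : 'rV[R]_n) :
    [forall i, `|((row_mx t%:M y : 'rV[R]_(1 + n)) - c)%R 0%R i| < r]%R
    = ((`|t - c0| < r) && [forall i, `|(y - c')%R 0%R i| < r])%R.
    apply/forallP/andP => [H|[H0 /forallP H] i].
      split; last first.
        apply/forallP => i; have := H (rshift 1 i).
        by rewrite mxE row_mxEr !mxE.
      have := H (lshift n 0%R); rewrite mxE row_mxEl !mxE mulr1n.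
      by rewrite (_ : lshift n 0%R = 0%R) //; exact: val_inj.
    case: (split_ordP (i : 'I_(1 + n))) => j ->.
      rewrite mxE row_mxEl !mxE ord1 mulr1n (_ : lshift n 0%R = 0%R) //; exact: val_inj.
    by rewrite mxE row_mxEr; have := H j; rewrite !mxE.
  rewrite (_ : (fun y : 'rV[R]_n => _) = fun y =>
    if ((`|t - c0| < r) && [forall i, `|(y - c')%R 0%R i| < r])%R then k%:E else 0);
    last by apply/funext => y; rewrite ec.
  rewrite patchE mem_setE in_itv /= -ltr_distl.
  by case: (`|t - c0| < r)%R => /=; [exact: IH | exact: iint0].
under eq_integral => t _ do rewrite e.
rewrite -integral_mkcond integral_cst //.
rewrite [X in _ * X](lebesgue_measure_itv `](c0 - r)%R, (c0 + r)%R[) /= lte_fin.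
rewrite ifT; last by rewrite ltrD2l gt0_cp.
by rewrite -EFinB -EFinM; congr EFin; rewrite exprSr; ring.
Qed.

End IteratedIntegral.

Lemma ball_coords (R : realType) n (x y : 'rV[R]_n) r : 0 < r ->
  (`|x - y| < r) = [forall i, `|(x - y) 0 i| < r].
Proof.
move=> r0; apply/idP/forallP => [xr i|xr]; first exact: le_lt_trans (rV_coord_le _ i) xr.
rewrite /Num.Def.normr /= mx_normrE; apply/bigmax_ltP; split=> //.
by move=> [i j] _ /=; rewrite (ord1 i); exact: xr.
Qed.

Section Volume.
Context {R : realType} {n : nat} (M : smoothManifold R n).
Variables (g : tensor2 M) (f : M -> R) (tau : R)
  (vol : {measure set (borelM M) -> \bar R}).
Hypothesis soliton : gradient_shrinking_soliton g f tau.
Hypothesis vol_g : riemannian_volume g vol.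
Implicit Types (p : M) (u v : M -> R).

Lemma measurable_openM (U : set M) : open U -> measurable (U : set (borelM M)).
Proof. by move=> Uo; exact: sub_sigma_algebra. Qed.

Lemma measurable_continuousM u : continuous u ->
  measurable_fun setT (u : borelM M -> R).
Proof.
move=> /continuousP uc; apply: (measurability _ (RGenOpens.measurableE R)).
move=> _ [_ [a [b ->] <-]]; rewrite setTI; apply: measurable_openM.
by apply: uc; exact: interval_open.
Qed.

(** On a small coordinate cube the density lies between half and twice its value at the centre, so
    the volume is squeezed between constants times the volume of the cube. *)
Lemma small_open_nbhs p (N : set M) : nbhs p N ->
  exists U : set M, [/\ open U, U p, U `<=` N, (0 < vol U)%E & (vol U < +oo)%E].
Proof.
move=> Np; pose a := chart_at p; have ap : dom a p := mem_chart_at p.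
pose x0 := coord a p; have ax0 : chart_img a x0 := chart_img_coord ap.
pose s := sqrt_det g a; have s0 : 0 < s x0 := sqrt_det_gt0 soliton ax0.
have na : nbhs x0 (chart_img a).
  by apply: open_nbhs_nbhs; split=> //; exact: open_chart_img.
have nN : nbhs x0 [set y | N (param a y)].
  by have := param_continuous ax0; apply; rewrite coordK.
have ns : nbhs x0 [set y | `|s x0 - s y| < s x0 / 2].
  have /cvgrPdist_lt := continuous_sqrt_det soliton ax0.
  by apply; rewrite divr_gt0.
have nS : nbhs x0 [set y | chart_img a y /\ N (param a y) /\ `|s x0 - s y| < s x0 / 2].
  exact: filterI na (filterI nN ns).
have /nbhs_ballP[r r0 rS] := nS.
have {}rS y : `|y - x0| < r ->
    [/\ chart_img a y, N (param a y) & `|s x0 - s y| < s x0 / 2].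
  move=> yr; have yb : ball x0 r y by rewrite -ball_normE /ball_ /= distrC.
  by have [y1 [y2 y3]] := rS y yb.
pose U := [set q | dom a q /\ `|coord a q - x0| < r].
have Uo : open U.
  rewrite openE => q [aq qr]; rewrite /interior.
  have n1 : nbhs q (dom a) by apply: open_nbhs_nbhs; split=> //; exact: open_dom.
  have n2 : nbhs (coord a q) [set y | `|y - x0| < r].
    have : open (ball x0 r) by exact: ball_open.
    move=> bo; have : nbhs (coord a q) (ball x0 r).
      apply: open_nbhs_nbhs; split=> //.
      by rewrite -ball_normE /ball_ /= distrC.
    by apply: filterS => y; rewrite -ball_normE /ball_ /= distrC.
  have n3 := coord_continuous aq n2.
  by apply: filterS (filterI n1 n3) => z [].
have Up : U p by split; rewrite ?subrr ?normr0.
have UE : vol U = lebesgue_iint (fun x => if x \in chart_img a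
      then (\1_U (param a x) * s x)%:E else 0%E).
  rewrite -[RHS](vol_g a (u := \1_U)) //; last first.
    by apply: measurable_indic; exact: measurable_openM.
  rewrite integral_indic //; last 2 first.
  - exact: measurable_openM (open_dom a).
  - exact: measurable_openM.
  by congr (vol _); apply/seteqP; split=> q; [move=> [] | case].
have in_ball x : `|x - x0| < r -> x \in chart_img a /\ \1_U (param a x) = 1 :> R.
  move=> xr; have [ax _ _] := rS x xr; split; first exact: mem_set.
  have [ax1 ax2] := chart_imgP ax.
  by rewrite indicE mem_set //; split=> //; rewrite ax2.
have out_ball x : ~~ (`|x - x0| < r) -> x \in chart_img a -> \1_U (param a x) = 0 :> R.
  move=> xr /set_mem/chart_imgP[_ ax]; rewrite indicE memNset //.
  by case=> _; rewrite ax; exact/negP.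
have s_bounds x : `|x - x0| < r -> s x0 / 2 <= s x <= 2 * s x0.
  move=> /rS[_ _]; rewrite ltr_distl => /andP[lo hi]; apply/andP; split; lra.
exists U; split=> //.
- by move=> q [aq qr]; have [_ + _] := rS _ qr; rewrite coordK.
- rewrite UE; apply: (@lt_le_trans _ _ (lebesgue_iint (fun x =>
    if [forall i, `|(x - x0) 0 i| < r] then (s x0 / 2)%:E else 0%E))).
    rewrite iint_box // lte_fin mulr_gt0 ?divr_gt0 // exprn_gt0 // addr_gt0 //.
  apply: iint_mono => x; rewrite -ball_coords //; case: ifPn => xr //.
  - by rewrite lee_fin divr_ge0 // ltW.
  - by have [-> ->] := in_ball x xr; rewrite mul1r lee_fin; case/andP: (s_bounds x xr).
  - by case: ifP => // xa; rewrite lee_fin mulr_ge0 // sqrtr_ge0.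
- rewrite UE; apply: (@le_lt_trans _ _ (lebesgue_iint (fun x =>
    if [forall i, `|(x - x0) 0 i| < r] then (2 * s x0)%:E else 0%E))).
    apply: iint_mono => x.
      by case: ifP => // xa; rewrite lee_fin mulr_ge0 // sqrtr_ge0.
    rewrite -ball_coords //; case: (boolP (`|x - x0| < r)) => xr.
      by have [-> ->] := in_ball x xr; rewrite mul1r lee_fin; case/andP: (s_bounds x xr).
    by case: ifP => // xa; rewrite (out_ball x xr xa) mul0r.
  by rewrite iint_box // ltry.
Qed.

Hypothesis M_compact : compact [set: M].

Lemma vol_finite : (vol setT < +oo)%E.
Proof.
have exU p : exists U : set M, [/\ open U, U p, U `<=` setT, (0 < vol U)%E & (vol U < +oo)%E].
  by apply: small_open_nbhs; exact: filterT.
have [U UP] := choice exU.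
have := M_compact; rewrite compact_cover => /(_ M setT U)[].
- by move=> p _; have [] := UP p.
- by move=> p _; exists p => //; have [] := UP p.
move=> D _ cov; have eT : setT = \big[setU/set0]_(p <- finmap.enum_fset D) U p.
  apply/seteqP; split=> // p /cov[q qD qp].
  by rewrite -bigcup_seq; exists q.
rewrite eT.
(* Measurability is carried along in the induction because subadditivity asks for it. *)
suff [] : measurable (\big[setU/set0]_(p <- finmap.enum_fset D) U p : set (borelM M)) /\
    (vol (\big[setU/set0]_(p <- finmap.enum_fset D) U p) < +oo)%E by [].
apply: (big_ind (fun A : set (borelM M) => measurable A /\ (vol A < +oo)%E)).
- by rewrite measure0.
- move=> A B [mA A1] [mB B1]; split; first exact: measurableU.
  by apply: le_lt_trans (measureU2 _ mA mB) _; rewrite lte_add_pinfty.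
by move=> p _; have [Uo _ _ _ Ufin] := UP p; split=> //; exact: measurable_openM.
Qed.

Lemma integrable_continuousM u : continuous u ->
  vol.-integrable setT (EFin \o (u : borelM M -> R)).
Proof.
move=> cu; apply: measurable_bounded_integrable => //.
- exact: vol_finite.
- exact: measurable_continuousM.
have cK : compact (u @` setT).
  by apply: continuous_compact => //; exact: continuous_subspaceT.
have [B [Br uB]] := compact_bounded cK.
exists B; split=> // x Bx y _ /=.
by apply: (uB x Bx); exists y.
Qed.

Lemma continuous_weight u : continuous u -> continuous (fun p => u p * expR (- f p)).
Proof.
move=> cu p; apply: (@continuousM _ _ u (fun p => expR (- f p)) p); first exact: cu.
have cf : {for p, continuous (fun p => - f p)}.
  by apply: (@continuousN _ _ _ f); exact: continuous_potential soliton p.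
by apply: continuous_comp cf _; exact: continuous_expR.
Qed.

Lemma wintD u v : continuous u -> continuous v ->
  wint f vol (fun p => u p + v p) = wint f vol u + wint f vol v.
Proof.
move=> cu cv; rewrite /wint -RintegralD //; last 2 first.
- exact: integrable_continuousM (continuous_weight cu).
- exact: integrable_continuousM (continuous_weight cv).
by apply: eq_Rintegral => p _; rewrite mulrDl.
Qed.

Lemma wintZ c u : continuous u ->
  wint f vol (fun p => c * u p) = c * wint f vol u.
Proof.
move=> cu; rewrite /wint -RintegralZl //.
  by apply: eq_Rintegral => p _; rewrite mulrA.
exact: integrable_continuousM (continuous_weight cu).
Qed.

(** By continuity the weighted function exceeds half its value at [p] on an open set of positive
    volume. *)
Lemma wint_gt0 u p : continuous u -> (forall q, 0 <= u q) -> 0 < u p ->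
  0 < wint f vol u.
Proof.
move=> cu u0 up; pose w q := u q * expR (- f q).
have cw : continuous w := continuous_weight cu.
have wp : 0 < w p by rewrite mulr_gt0 // expR_gt0.
have w0 q : 0 <= w q by rewrite mulr_ge0 // expR_ge0.
have nw : nbhs p [set q | w p / 2 < w q].
  have /cvgrPdist_lt/(_ (w p / 2)) := cw p.
  move=> /(_ (divr_gt0 wp (ltr0n _ 2))); apply: filterS => q.
  by rewrite /= ltr_distl => /andP[lo hi]; lra.
have [U [Uo Up UN U0 _]] := small_open_nbhs nw.
have mU : measurable (U : set (borelM M)) := measurable_openM Uo.
(* Finiteness matters for positivity: [Rintegral] sends an infinite integral to 0. *)
have I : (\int[vol]_x (w x)%:E < +oo)%E.
  have := integrable_continuousM cw; move=> /integrableP[_].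
  by under eq_integral => x _ do rewrite /= ger0_norm //.
have L : (0 < \int[vol]_x (w x)%:E)%E.
  apply: (@lt_le_trans _ _ ((w p / 2)%:E * vol U)%E).
    by rewrite mule_gt0 // lte_fin divr_gt0.
  rewrite -integral_cst // integral_mkcond; apply: ge0_integral_mono => q.
    by rewrite patchE; case: ifP => // _; rewrite lee_fin ltW // divr_gt0.
  rewrite patchE; case: ifPn => [/set_mem/UN /ltW|_]; rewrite lee_fin //.
by rewrite /wint /Rintegral fine_gt0 // L.
Qed.

End Volume.

(** * Local maxima and linearity *)

Section LocalMaximum.
Context {R : realType} {n : nat} {V : set 'rV[R]_n} (Vo : open V).
Variables (u : 'rV[R]_n -> R) (x : 'rV[R]_n) (i : 'I_n).
Hypotheses (smooth_u : smooth_on V u) (Vx : V x)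
  (max_u : forall y, V y -> u y <= u x).

Local Notation e := (delta_mx 0 i : 'rV[R]_n).

Let small : exists2 r, 0 < r & forall t, `|t| < r -> V (x + t *: e).
Proof.
have [r r0 rV] := open_ball_sub Vo Vx; exists r => // t tr; apply: rV.
rewrite addrAC subrr add0r normrZ; apply: le_lt_trans tr.
by rewrite ler_piMr // norm_delta_le.
Qed.

Lemma pd_max : pd i u x = 0.
Proof.
have [r r0 rV] := small.
have inr t : t \in `](- r), r[%R -> V (x + t *: e).
  by rewrite in_itv /= => tr; apply: rV; rewrite ltr_norml.
have D t : t \in `](- r), r[%R ->
    is_derive t (1 : R) (fun s : R => u (x + s *: e)) (pd i u (x + t *: e)).
  by move=> /inr Vt; apply: is_derive_line; exact: smooth_derivable smooth_u Vt.
have r00 : 0 \in `](- r), r[%R by rewrite in_itv /= oppr_lt0 r0.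
have le_r : - r <= r by rewrite ge0_cp // ltW.
have D0 : is_derive (0 : R) (1 : R) (fun s : R => u (x + s *: e)) 0.
  apply: (derive1_at_max le_r _ r00) => [t /D []//|t /inr Vt].
  by rewrite scale0r addr0; exact: max_u.
have [_ e1] := D 0 r00; have [_ e2] := D0.
by move: e1; rewrite e2 scale0r addr0.
Qed.

(** A positive second derivative would stay positive near [x]; as the first one vanishes at [x], two
    uses of the mean value theorem would make [u] larger than its maximum a little further along the
    line. *)
Lemma pd2_max : pd i (pd i u) x <= 0.
Proof.
rewrite leNgt; apply/negP => pos.
have [r r0 rV] := small.
have c2 : {for x, continuous (pd i (pd i u))}.
  exact: smooth_continuous (smooth_pd i (smooth_pd i smooth_u)) Vx.
have [d d0 dP] : exists2 d, 0 < d & forall y, `|y - x| < d -> 0 < pd i (pd i u) y.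
  have /cvgrPdist_lt/(_ _ pos) N := c2.
  have N' : nbhs x [set y | `|pd i (pd i u) x - pd i (pd i u) y| < pd i (pd i u) x].
    exact: N.
  have /nbhs_ballP[d d0 dP] := N'; exists d; [exact: d0 | move=> y yd].
  have /= : ball x d y by rewrite -ball_normE /ball_ /= distrC.
  by move=> /dP; rewrite /= ltr_distl => /andP[_]; rewrite ltrDr.
have [t t0 tm] : exists2 t, 0 < t & t < Num.min r d.
  have m0 : 0 < Num.min r d by rewrite lt_min r0.
  by exists (Num.min r d / 2); [rewrite divr_gt0 | rewrite ltr_pdivrMr // ltr_pMr // ltr1n].
have [tr td] : t < r /\ t < d by move: tm; rewrite lt_min => /andP.
have cont s : 0 <= s <= 1 -> V (x + (s * t) *: e) /\ `|x + (s * t) *: e - x| < d.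
  move=> /andP[s0 s1]; have st : `|s * t| <= t.
    by rewrite ger0_norm ?mulr_ge0 ?(ltW t0) // ler_piMl // ltW.
  split; first by apply: rV; exact: le_lt_trans st tr.
  rewrite addrAC subrr add0r normrZ; apply: le_lt_trans td; apply: le_trans st.
  by rewrite ler_piMr // norm_delta_le.
have [s s01|s [s01 es]] := @line_MVT _ _ u x e t.
  by apply: smooth_derivable smooth_u _; exact: (cont s s01).1.
have {}s01' : 0 <= s <= 1 by case/andP: s01 => /ltW -> /ltW ->.
have cont2 q : 0 <= q <= 1 -> 0 <= q * s <= 1.
  move=> /andP[q0 q1]; case/andP: s01' => s0 s1; rewrite mulr_ge0 //=.
  by rewrite mulr_ile1.
have [q q01|q [q01 eq]] := @line_MVT _ _ (pd i u) x e (s * t).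
  rewrite mulrA; apply: smooth_derivable (smooth_pd i smooth_u) _.
  exact: (cont _ (cont2 q q01)).1.
have q01' : 0 <= q <= 1 by case/andP: q01 => /ltW -> /ltW ->.
have pq : 0 < pd i (pd i u) (x + (q * (s * t)) *: e).
  by apply: dP; rewrite mulrA; exact: (cont _ (cont2 q q01')).2.
have ps : 0 < pd i u (x + (s * t) *: e).
  move: eq; rewrite pd_max subr0 => ->; apply: mulr_gt0 => //.
  by rewrite mulr_gt0 //; case/andP: s01.
have c1 : 0 <= (1 : R) <= 1 by rewrite ler01 lexx.
have := max_u (cont 1 c1).1; rewrite mul1r -subr_le0 es.
by rewrite leNgt mulr_gt0.
Qed.

End LocalMaximum.

(** * Locality and linearity of the operators *)

Lemma lin_mxE (R : pzRingType) m n (A B : 'M[R]_(m, n)) c d i j :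
  (c *: A + d *: B) i j = c * A i j + d * B i j.
Proof. by rewrite !mxE. Qed.

Section Linearity.
Context {R : realType} {n : nat} {V : set 'rV[R]_n} (Vo : open V).
Variables (g : 'rV[R]_n -> 'M[R]_n) (f : 'rV[R]_n -> R).
Implicit Types (h k : 'rV[R]_n -> 'M[R]_n) (x : 'rV[R]_n) (c d : R).
Hypothesis smooth_g : forall i j : 'I_n, smooth_on V (fun x => g x i j).
Hypothesis g_unit : forall x, V x -> g x \in unitmx.

Lemma cov1_zero_on (w : 'rV[R]_n -> 'rV[R]_n) x : V x ->
  (forall y, V y -> w y = 0) -> cov1 g w x = 0.
Proof.
move=> Vx w0; apply/matrixP => i j; rewrite /cov1 [LHS]mxE [RHS]mxE.
rewrite (pd_eq_on (v := fun=> 0) i Vo Vx) ?pd_cst => [|y Vy]; last by rewrite w0 ?mxE.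
by rewrite big1 ?subrr // => l _; rewrite w0 // mxE mulr0.
Qed.

Lemma cov2_eq_on h k l i j x : V x -> (forall y, V y -> h y = k y) ->
  cov2 g h l i j x = cov2 g k l i j x.
Proof.
move=> Vx e; apply: (f_equal2 (fun r s : R => r - s)).
  by apply: pd_eq_on Vo Vx _ => y Vy; rewrite e.
by apply: eq_bigr => p _; rewrite e.
Qed.

(** Equality of tensors is known on chart images only; locality carries it through the operator. *)
Lemma Lf_eq_on h k x : V x -> (forall y, V y -> h y = k y) ->
  Lf g f h x = Lf g f k x.
Proof.
move=> Vx e; apply: (f_equal2 (fun X Y : 'M[R]_n => 2^-1 *: X + Y)).
  apply/matrixP => i j; rewrite [LHS]mxE [RHS]mxE; apply: eq_bigr => p _.
  apply: eq_bigr => q _; have e2 a b r y : V y -> cov2 g h a b r y = cov2 g k a b r y.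
    by move=> Vy; exact: cov2_eq_on.
  apply: (f_equal2 (fun r s : R => ginv g p q x * (r - pd p f x * s))); last exact: e2.
  apply: (f_equal2 (fun r s : R => r - s)).
    by apply: pd_eq_on Vo Vx _ => y Vy; exact: e2.
  by apply: eq_bigr => l _; rewrite !e2.
apply/matrixP => i j; rewrite [LHS]mxE [RHS]mxE.
by do 4 ! (apply: eq_bigr => ? _); rewrite e.
Qed.

Lemma pd_lin c d u v i x : smooth_on V u -> smooth_on V v -> V x ->
  pd i (fun y => c * u y + d * v y) x = c * pd i u x + d * pd i v x.
Proof.
move=> su sv Vx; have scu := smooth_cst V c; have scd := smooth_cst V d.
rewrite pdD; last 2 first.
- exact: smooth_derivable (smoothM Vo scu su) Vx.
- exact: smooth_derivable (smoothM Vo scd sv) Vx.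
rewrite !pdM ?pd_cst ?mul0r ?add0r //;
  by [exact: smooth_derivable Vx | exact: derivable_cst].
Qed.

Section LinearCombination.
Variables (c d : R) (h k : 'rV[R]_n -> 'M[R]_n).
Hypothesis smooth_h : forall i j : 'I_n, smooth_on V (fun x => h x i j).
Hypothesis smooth_k : forall i j : 'I_n, smooth_on V (fun x => k x i j).

Local Notation hk := (fun x => c *: h x + d *: k x).

Let hkE x i j : hk x i j = c * h x i j + d * k x i j.
Proof. by rewrite !mxE. Qed.

Lemma cov2_lin l i j x : V x ->
  cov2 g hk l i j x = c * cov2 g h l i j x + d * cov2 g k l i j x.
Proof.
move=> Vx; rewrite /cov2.
rewrite (pd_eq_on (v := fun y => c * h y i j + d * k y i j) l Vo Vx) => [|y _];
  last by rewrite hkE.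
rewrite pd_lin //.
under eq_bigr => p _ do rewrite !hkE.
have -> : forall a b r s : R, c * (a - r) + d * (b - s)
    = c * a + d * b - (c * r + d * s) by move=> *; ring.
congr (_ - _); rewrite !mulr_sumr -big_split; apply: eq_bigr => p _ /=; ring.
Qed.

Lemma smooth_cov2 (s : 'rV[R]_n -> 'M[R]_n) l i j :
  (forall i j : 'I_n, smooth_on V (fun x => s x i j)) ->
  smooth_on V (cov2 g s l i j).
Proof.
move=> ss; have sc p q r := smooth_christoffel Vo smooth_g g_unit p q r.
have sp := smooth_pd l (ss i j).
have sS : smooth_on V (fun x => \sum_p (christoffel g p l i x * s x p j
    + christoffel g p l j x * s x i p)).
  apply: smooth_sum => // p _; apply: smoothD => //; exact: smoothM.
exact: smoothD Vo sp (smoothN Vo sS).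
Qed.

Lemma Lf_lin x : V x -> Lf g f hk x = c *: Lf g f h x + d *: Lf g f k x.
Proof.
move=> Vx; rewrite /Lf; have -> : laplf2 g f hk x = c *: laplf2 g f h x + d *: laplf2 g f k x.
  apply/matrixP => i j; rewrite [RHS]lin_mxE ![laplf2 _ _ _ _ _ _]mxE.
  rewrite !mulr_sumr -big_split; apply: eq_bigr => p _ /=.
  rewrite !mulr_sumr -big_split; apply: eq_bigr => q _ /=.
  have -> : cov3 g (cov2 g hk) p q i j x
      = c * cov3 g (cov2 g h) p q i j x + d * cov3 g (cov2 g k) p q i j x.
    rewrite /cov3 (pd_eq_on (v := fun y => c * cov2 g h q i j y + d * cov2 g k q i j y)
      p Vo Vx) => [|y Vy]; last exact: cov2_lin.
    rewrite pd_lin //; try exact: smooth_cov2.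
    under eq_bigr => l _ do rewrite !cov2_lin //.
    have -> : forall a b r s : R, c * (a - r) + d * (b - s)
        = c * a + d * b - (c * r + d * s) by move=> *; ring.
    congr (_ - _); rewrite !mulr_sumr -big_split; apply: eq_bigr => l _ /=; ring.
  by rewrite cov2_lin //; ring.
have -> : Rm_act g hk x = c *: Rm_act g h x + d *: Rm_act g k x.
  apply/matrixP => i j; rewrite [RHS]lin_mxE ![Rm_act _ _ _ _ _]mxE.
  rewrite !mulr_sumr -big_split; apply: eq_bigr => p _ /=.
  rewrite !mulr_sumr -big_split; apply: eq_bigr => q _ /=.
  rewrite !mulr_sumr -big_split; apply: eq_bigr => r _ /=.
  rewrite !mulr_sumr -big_split; apply: eq_bigr => s _ /=.
  by rewrite hkE; ring.
by rewrite !scalerDr !scalerA !(mulrC 2^-1) addrACA.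
Qed.

Lemma divf2_lin x : V x ->
  divf2 g f hk x = c *: divf2 g f h x + d *: divf2 g f k x.
Proof.
move=> Vx; apply/rowP => i; rewrite [RHS]lin_mxE ![divf2 _ _ _ _ _ _]mxE.
rewrite !mulr_sumr -big_split; apply: eq_bigr => p _ /=.
rewrite !mulr_sumr -big_split; apply: eq_bigr => q _ /=.
by rewrite cov2_lin // hkE; ring.
Qed.

End LinearCombination.

End Linearity.

(** * Linear stability *)

Section Main.
Context {R : realType} {n : nat} (M : smoothManifold R n).
Variables (g : tensor2 M) (f : M -> R) (tau : R)
  (vol : {measure set (borelM M) -> \bar R}).
Implicit Types (a b : chart M) (x : 'rV[R]_n) (p : M) (h k : tensor2 M).
Hypotheses (M_compact : compact [set: M]) (tau_gt0 : 0 < tau)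
  (soliton : gradient_shrinking_soliton g f tau)
  (vol_g : riemannian_volume g vol).

Local Notation mu := ((2 * tau)^-1).

Let mu_gt0 : 0 < mu.
Proof. by rewrite invr_gt0 mulr_gt0. Qed.

(* If Rc = 0 then the Hessian of f is positive definite, which is absurd at a
   maximum of f. *)
Lemma Rc_nonzero : (0 < n)%N -> nonzero2 (Rc g).
Proof.
move=> n_gt0 Rc0; have cf := continuous_potential soliton.
have [|p _ fmax] := @compact_EVT_max M R f setT _ M_compact (continuous_subspaceT cf).
  by exists point.
pose a := chart_at p; have ap : dom a p := mem_chart_at p.
pose x := coord a p; have ax : chart_img a x := chart_img_coord ap.
pose u := f \o param a; have su : smooth_on (chart_img a) u := potential_smooth soliton a.
have umax y : chart_img a y -> u y <= u x.
  by move=> _; rewrite /u /= coordK //; apply: fmax; rewrite inE.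
have ao := @open_chart_img _ _ M a.
pose i := Ordinal n_gt0.
have := congr1 (fun X : 'M[R]_n => X i i) (soliton_eq soliton ax).
have -> : ricci (g a) x = 0 by exact: Rc0.
rewrite add0r /hess /cov1 [LHS]mxE [RHS]mxE => e.
have e1 : pd i (fun y => grad u y 0 i) x = pd i (pd i u) x.
  by apply: pd_eq_on ao ax _ => y _; rewrite mxE.
(* At the maximum the gradient vanishes, so the Hessian reduces to second partial derivatives. *)
have e2 : \sum_l christoffel (g a) l i i x * grad u x 0 l = 0.
  by apply: big1 => l _; rewrite mxE (pd_max ao l su ax umax) mulr0.
have gii : 0 < g a x i i.
  have := metric_posdef soliton ax (y := delta_mx 0 i).
  rewrite -rowE trmx_delta -colE !mxE; apply.
  by apply/eqP => /matrixP/(_ 0 i)/eqP; rewrite !mxE !eqxx oner_eq0.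
have := pd2_max ao i su ax umax; rewrite leNgt => /negP; apply.
by move: e; rewrite e1 e2 subr0 => ->; exact: mulr_gt0.
Qed.

Lemma smooth_sym2_lin c d h k : smooth_sym2 h -> smooth_sym2 k ->
  smooth_sym2 (fun a x => c *: h a x + d *: k a x).
Proof.
move=> [sh hT ht] [sk kT kt]; split=> [a i j|a x ax|a b x Wx].
- have ao := @open_chart_img _ _ M a.
  apply: smooth_ext (smoothD ao (smoothM ao (smooth_cst _ c) (sh a i j))
    (smoothM ao (smooth_cst _ d) (sk a i j))) => // x _.
  by rewrite lin_mxE.
- by rewrite linearD !linearZ /= hT // kT.
by rewrite mulmxDr mulmxDl -!scalemxAr -!scalemxAl (ht a b) // (kt a b).
Qed.

Lemma ker_divf_lin c d h k : ker_divf g f h -> ker_divf g f k ->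
  ker_divf g f (fun a x => c *: h a x + d *: k a x).
Proof.
move=> [sh h0] [sk k0]; split; first exact: smooth_sym2_lin.
move=> a x ax; have [sh' _ _] := sh; have [sk' _ _] := sk.
rewrite (divf2_lin (@open_chart_img _ _ M a)) //.
by rewrite h0 // k0 // !scaler0 addr0.
Qed.

Lemma calLf_lin c d h k a x : smooth_sym2 h -> smooth_sym2 k -> chart_img a x ->
  calLf g f (fun a x => c *: h a x + d *: k a x) a x
  = c *: calLf g f h a x + d *: calLf g f k a x.
Proof.
move=> [sh _ _] [sk _ _] ax.
exact: (Lf_lin (@open_chart_img _ _ M a) _ (metric_smooth soliton a)
  (@metric_unit _ _ _ _ _ _ soliton a) c d (sh a) (sk a) ax).
Qed.

Lemma inner_lin c d h h' k k' p :
  (forall a x, chart_img a x -> k' a x = c *: h a x + d *: h' a x) ->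
  inner g k' k p = c * inner g h k p + d * inner g h' k p.
Proof.
move=> e; have ap := chart_img_coord (mem_chart_at p).
rewrite /inner /at_point !inner2E (e _ _ ap).
rewrite mulmxDr !mulmxDl linearD /= -!scalemxAr -!scalemxAl.
by rewrite !linearZ.
Qed.

Lemma innerC h k p : smooth_sym2 h -> smooth_sym2 k -> inner g h k p = inner g k h p.
Proof.
move=> [_ hT _] [_ kT _]; have ap := chart_img_coord (mem_chart_at p).
rewrite /inner /at_point !inner2E; set G := invmx _.
have GT : G^T = G by rewrite trmx_inv (metric_sym soliton).
rewrite -[LHS]mxtrace_tr !trmx_mul !trmxK GT hT // mulmxA mxtrace_mulC.
by rewrite [RHS]mxtrace_mulC !mulmxA.
Qed.

Lemma ker_divf_Rc : ker_divf g f (Rc g).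
Proof.
split; first exact: smooth_sym2_Rc soliton.
by move=> a x ax; exact: (divf2_Rc soliton ax).
Qed.

(** When $\operatorname{div}_fh=0$ the equation for $\hat v_h$ is homogeneous, so stability can be
    tested with the zero function. *)
Lemma is_vhat0 h : ker_divf g f h -> is_vhat g f tau vol h (fun=> 0).
Proof.
move=> [sh h0]; split=> [a|a x ax|].
- by apply: smooth_cst.
- have ao := @open_chart_img _ _ M a.
  have Hs : hess (g a) (fun=> 0) x = 0.
    apply: (cov1_zero_on ao) => // y _.
    by apply/rowP => i; rewrite !mxE pd_cst.
  rewrite mul0r addr0 /laplf0 big1 => [|k _]; last first.
    apply: big1 => l _; rewrite Hs mxE.
    have -> : pd l ((fun=> 0) \o param a) x = 0 :> R by exact: pd_cst.
    by rewrite mulr0 subrr mulr0.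
  rewrite /divf1 big1 // => k _; apply: big1 => l _.
  rewrite (cov1_zero_on ao) // => [|y ay]; last exact: h0.
  by rewrite h0 // !mxE mul0r subrr mulr0.
rewrite /wint; under eq_Rintegral => x _ do rewrite mul0r.
by rewrite /Rintegral integral0.
Qed.

(** The terms of $\hat N$ beyond $\mathcal L_f$ vanish one by one: the divergence is zero, $\hat v$
    is zero, and orthogonality to $Rc$ kills the numerator of the last term. *)
Lemma stabN_ker_divf h a x : ker_divf g f h -> wint f vol (inner g (Rc g) h) = 0 ->
  chart_img a x -> stabN g f vol h (fun=> 0) a x = calLf g f h a x.
Proof.
move=> [sh h0] w0 ax; have ao := @open_chart_img _ _ M a.
rewrite /stabN w0 mul0r scale0r subr0.
have -> : divf_dagger (g a) (divf2 (g a) (f \o param a) (h a)) x = 0.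
  have c0 : cov1 (g a) (divf2 (g a) (f \o param a) (h a)) x = 0.
    by apply: (cov1_zero_on ao) => // y ay; exact: h0.
  by apply/matrixP => i j; rewrite [LHS]mxE c0 !mxE addr0 mulr0.
have -> : hess (g a) ((fun=> 0) \o param a) x = 0.
  apply: (cov1_zero_on ao) => // y _.
  by apply/rowP => i; rewrite !mxE pd_cst.
by rewrite scaler0 !addr0.
Qed.

Hypothesis stable : linearly_stable g f tau vol.
Hypothesis n_gt0 : (0 < n)%N.

(** This is the denominator of the projection onto $Rc$. *)
Lemma wint_Rc_gt0 : 0 < wint f vol (inner g (Rc g) (Rc g)).
Proof.
have sRc := smooth_sym2_Rc soliton.
have [p /eqP p0] : exists p, inner g (Rc g) (Rc g) p <> 0.
  apply/existsNP => Rc0; apply: (Rc_nonzero n_gt0).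
  exact: (inner_eq0 soliton sRc Rc0).
apply: (wint_gt0 soliton vol_g M_compact (p := p)).
- exact: (continuous_inner soliton).
- exact: inner_ge0 soliton (Rc g).
by rewrite lt_neqAle eq_sym p0; exact: inner_ge0 soliton (Rc g) p.
Qed.

(* The component of h orthogonal to Rc is a test tensor on which the quadratic
   form of the stability operator equals -lambda times the squared norm. *)
Lemma eigenspace_neg lambda h : lambda < 0 -> eigenspace_Lf g f lambda h ->
  exists s, eq_tensor2 h (fun a x => s *: Rc g a x).
Proof.
move=> l0 [kh eh]; have kRc := ker_divf_Rc.
have sRc := kRc.1; have sh := kh.1.
pose c := wint f vol (inner g (Rc g) (Rc g)).
have c0 : 0 < c := wint_Rc_gt0.
(* The coefficient of the projection of [h] onto $Rc$ in the weighted $L^2$ product. *)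
pose s := wint f vol (inner g h (Rc g)) / c.
pose h' : tensor2 M := fun a x => 1 *: h a x + (- s) *: Rc g a x.
have kh' : ker_divf g f h' by exact: ker_divf_lin.
have sh' := kh'.1.
have ci k1 k2 : smooth_sym2 k1 -> smooth_sym2 k2 -> continuous (inner g k1 k2).
  exact: (continuous_inner soliton).
have wintL (r1 r2 : R) (u1 u2 u3 : M -> R) : continuous u1 -> continuous u2 ->
    (forall p, u3 p = r1 * u1 p + r2 * u2 p) ->
    wint f vol u3 = r1 * wint f vol u1 + r2 * wint f vol u2.
  move=> cu1 cu2 e.
  have cr (r : R) (u : M -> R) : continuous u -> continuous (fun p => r * u p).
    move=> cu p; apply: (@continuousM _ _ (fun=> r) u p); last exact: cu.
    exact: cst_continuous.
  rewrite -!(wintZ soliton vol_g M_compact) // -(wintD soliton vol_g M_compact); try exact: cr.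
  by congr (wint f vol _); apply/funext.
have w0 : wint f vol (inner g (Rc g) h') = 0.
  rewrite (_ : inner g (Rc g) h' = inner g h' (Rc g)); last first.
    by apply/funext => p; exact: innerC.
  rewrite (wintL 1 (- s) (inner g h (Rc g)) (inner g (Rc g) (Rc g))); last first.
  - by move=> p; apply: inner_lin.
  - exact: ci.
  - exact: ci.
  by rewrite mul1r -/c /s mulNr divfK ?subrr // gt_eqF.
have NE : wint f vol (inner g (stabN g f vol h' (fun=> 0)) h')
    = - lambda * wint f vol (inner g h' h').
  (* Here $\mathcal L_fh'=-\lambda h-s\mu Rc=-\lambda h'-s(\lambda+\mu)Rc$, and the last term
     integrates to zero against $h'$ by [w0]. *)
  rewrite (wintL (- lambda) (- (s * (lambda + mu))) (inner g h' h') (inner g (Rc g) h')).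
  - by rewrite w0 mulr0 addr0.
  - exact: ci.
  - exact: ci.
  move=> p; apply: inner_lin => a x ax.
  rewrite stabN_ker_divf // calLf_lin // (Lf_Rc soliton) // (eh _ _ ax) /h'.
  rewrite !scale1r scalerDr !scalerA -[RHS]addrA -scalerDl.
  by congr (_ + _ *: _); ring.
have le0 : wint f vol (inner g h' h') <= 0.
  have := stable sh' (is_vhat0 kh'); rewrite NE.
  by rewrite pmulr_rle0 // oppr_gt0.
(* A continuous non-negative integrand that is positive somewhere would have a positive integral. *)
have z p : inner g h' h' p = 0.
  apply/eqP; apply: contraT => p0; move: le0; rewrite leNgt => /negP; case.
  apply: (wint_gt0 soliton vol_g M_compact (p := p)); first exact: ci.
  - exact: inner_ge0 soliton h'.
  by rewrite lt_neqAle eq_sym p0; exact: inner_ge0 soliton h' p.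
exists s => a x ax; have := inner_eq0 soliton sh' z ax.
by rewrite /h' scale1r scaleNr => /eqP; rewrite subr_eq0 => /eqP.
Qed.

(** As a multiple of $Rc$, the eigentensor satisfies $\mathcal L_fh=\mu h$ besides $\mathcal
    L_fh=-\lambda h$, and it is not zero. *)
Lemma eigenvalue_neg lambda : lambda < 0 -> eigenvalue_Lf g f lambda -> lambda = - mu.
Proof.
move=> l0 [h [eh hn0]]; have [s hs] := eigenspace_neg l0 eh.
apply/eqP; rewrite -addr_eq0; apply: contraT => lmu; case: hn0 => a x ax.
have [[sh _] eL] := eh; have sRc := smooth_sym2_Rc soliton.
have e1 : calLf g f h a x = mu *: h a x.
  (* The zero summand gives the multiple of $Rc$ the shape that [calLf_lin] expects. *)
  have -> : calLf g f h a x = calLf g f (fun a x => 0 *: Rc g a x + s *: Rc g a x) a x.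
    apply: (Lf_eq_on (@open_chart_img _ _ M a)) => // y ay.
    by rewrite scale0r add0r; exact: hs.
  rewrite calLf_lin // (Lf_Rc soliton) // scale0r add0r (hs _ _ ax).
  by rewrite !scalerA mulrC.
have : (lambda + mu) *: h a x = 0.
  by rewrite scalerDl -e1 (eL _ _ ax) scaleNr subrr.
by move/eqP; rewrite scaler_eq0 (negbTE lmu) => /eqP.
Qed.

End Main.

Theorem theorem1p3 (R : realType) (n : nat) (M : smoothManifold R n)
  (g : tensor2 M) (f : M -> R) (tau : R)
  (vol : {measure set (borelM M) -> \bar R})
  (n_gt0 : (0 < n)%N)
  (M_compact : compact [set: M])
  (tau_gt0 : 0 < tau)
  (soliton : gradient_shrinking_soliton g f tau)
  (vol_g : riemannian_volume g vol)
  (stable : linearly_stable g f tau vol) :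
  [/\ eigentensor_Lf g f (- (2 * tau)^-1) (Rc g),
      forall lambda : R, lambda < 0 ->
        (eigenvalue_Lf g f lambda <-> lambda = - (2 * tau)^-1),
      multiplicity_one g f (- (2 * tau)^-1)
    & forall lambda : R, eigenvalue_Lf g f lambda -> - (2 * tau)^-1 <= lambda].
Proof.
have mu_lt0 : - (2 * tau)^-1 < 0 by rewrite oppr_lt0 invr_gt0 mulr_gt0.
have eRc : eigentensor_Lf g f (- (2 * tau)^-1) (Rc g).
  split; last exact: (Rc_nonzero M_compact tau_gt0 soliton n_gt0).
  split; first exact: ker_divf_Rc soliton.
  by move=> a x ax; rewrite (Lf_Rc soliton ax) opprK.
have neg := eigenvalue_neg M_compact tau_gt0 soliton vol_g stable n_gt0.
split=> // [lambda l0||lambda el].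
- by split=> [|->]; [exact: neg | exists (Rc g)].
- exists (Rc g) => // h.
  exact: (eigenspace_neg M_compact tau_gt0 soliton vol_g stable n_gt0 mu_lt0).
have [l0|l0] := ltP lambda 0; first by rewrite (neg lambda l0 el).
exact: ltW (lt_le_trans mu_lt0 l0).
Qed.
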